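(* Let $\{a_n\}_{n\ge1}$ be the enumeration of $\mathbb{Z}+i\mathbb{Z}\subset\mathbb{C}_z$ given by the spiral $0 \to 1 \to 1+i \to i \to -1+i \to -1 \to -1-i \to -i \to 1-i \to 2-i \to 2 \to \cdots$. There exists a decreasing sequence $\{\varepsilon_n\}$ of positive numbers converging to zero such that, with $E_n := \{(z,w)\in\mathbb{C}^2 : w = \varepsilon_1\sqrt{z-a_1}+\cdots+\varepsilon_n\sqrt{z-a_n}\}$ (all $2^n$ branches of the multivalued right-hand side taken), the sets $E_n$ converge, in the Hausdorff metric on each compact subset of $\mathbb{C}^2$, to a nonempty unbounded connected closed set $\mathcal{E} = \{ b \in \mathbb{C}^2 : \exists\, b_n \in E_n,\ n=1,2,\dots,\ \text{with } b=\lim_{n\to\infty} b_n\}$, and the following holds: if $\phi$ is a continuous plurisubharmonic function defined on an open neighborhood $V\subset\mathbb{C}^2$ of $\mathcal{E}$ and $\phi$ is bounded from above, then $\phi\equiv C$ on $\mathcal{E}$ for some constant $C\in\mathbb{R}$.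
   Context: $E_n$ is the zero set of the polynomial $P_n(z,w)=\prod_{k=1}^{2^n}(w-w_k^{(n)}(z))$, where $w_1^{(n)}(z),\dots,w_{2^n}^{(n)}(z)$ are the $2^n$ values (with multiplicity) of $\sum_{k=1}^n\varepsilon_k\sqrt{z-a_k}$. The set $\mathcal{E}$ is called a Wermer type set. *)

(* Defs.v *)
From Stdlib Require Import Reals ZArith Arith.
From Coquelicot Require Import Coquelicot.
Open Scope R_scope.

(* The spiral walk consists of segments k = 0,1,2,... of length k/2 + 1
   (i.e. 1,1,2,2,3,3,...) in directions right, up, left, down (cyclically). *)
Definition spiral_dir (k : nat) : Z * Z :=
  match (k mod 4)%nat with
  | 0%nat => (1, 0)%Z
  | 1%nat => (0, 1)%Z
  | 2%nat => (-1, 0)%Z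
  | _ => (0, -1)%Z
  end.

Definition seg_len (k : nat) : nat := (k / 2 + 1)%nat.

Fixpoint seg_of (fuel j k : nat) : nat :=
  match fuel with
  | O => k
  | S f => if Nat.ltb j (seg_len k) then k else seg_of f (j - seg_len k) (S k)
  end.

Definition step_dir (j : nat) : Z * Z := spiral_dir (seg_of (S j) j 0).

Fixpoint spiral_pos (m : nat) : Z * Z :=
  match m with
  | O => (0, 0)%Z
  | S m' =>
      let (x, y) := spiral_pos m' in
      let (dx, dy) := step_dir m' in ((x + dx)%Z, (y + dy)%Z)
  end.

(* a_n for n >= 1: a_1 = 0, a_2 = 1, a_3 = 1+i, a_4 = i, a_5 = -1+i, ... *)
Definition spiral (n : nat) : C :=
  let (x, y) := spiral_pos (n - 1) in (IZR x, IZR y).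

Definition C2 := (C * C)%type.

Definition dist2 (p q : C2) : R :=
  sqrt (Cmod (Cminus (fst p) (fst q)) ^ 2 + Cmod (Cminus (snd p) (snd q)) ^ 2).

Definition origin2 : C2 := (RtoC 0, RtoC 0).

Definition c2_line (a : C2) (zeta : C) (b : C2) : C2 :=
  (Cplus (fst a) (Cmult zeta (fst b)), Cplus (snd a) (Cmult zeta (snd b))).

Definition open2 (U : C2 -> Prop) : Prop :=
  forall p, U p -> exists r, 0 < r /\ forall q, dist2 p q < r -> U q.

Definition closed2 (A : C2 -> Prop) : Prop :=
  forall p, (forall r, 0 < r -> exists q, A q /\ dist2 p q < r) -> A p.

Definition connected2 (A : C2 -> Prop) : Prop :=
  forall U V : C2 -> Prop, open2 U -> open2 V ->
    (forall p, A p -> U p \/ V p) ->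
    (exists p, A p /\ U p) -> (exists p, A p /\ V p) ->
    exists p, A p /\ U p /\ V p.

Definition unbounded2 (A : C2 -> Prop) : Prop :=
  forall M : R, exists p, A p /\ M < dist2 origin2 p.

Definition seq_cv2 (b : nat -> C2) (p : C2) : Prop :=
  forall e, 0 < e -> exists N, forall n, (N <= n)%nat -> dist2 (b n) p < e.

Definition compact2 (K : C2 -> Prop) : Prop :=
  forall b : nat -> C2, (forall n, K (b n)) ->
    exists (s : nat -> nat) (p : C2),
      (forall n, (s n < s (S n))%nat) /\ K p /\ seq_cv2 (fun n => b (s n)) p.

Definition near_set (A : C2 -> Prop) (e : R) (p : C2) : Prop :=
  exists q, A q /\ dist2 p q < e.

Definition local_hausdorff_cv (A : nat -> C2 -> Prop) (B : C2 -> Prop) : Prop :=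
  forall K : C2 -> Prop, compact2 K -> forall e, 0 < e ->
    exists N, forall n, (N <= n)%nat ->
      (forall p, K p -> A n p -> near_set B e p) /\
      (forall p, K p -> B p -> near_set (A n) e p).

Fixpoint wsum (eps : nat -> R) (s : nat -> C) (n : nat) : C :=
  match n with
  | O => RtoC 0
  | S m => Cplus (wsum eps s m) (Cmult (RtoC (eps (S m))) (s (S m)))
  end.

(* E_n = {(z,w) : w = eps_1 sqrt(z-a_1) + ... + eps_n sqrt(z-a_n)},
   all 2^n branches: each s_k ranges over both square roots of z - a_k. *)
Definition E_n (eps : nat -> R) (n : nat) (p : C2) : Prop :=
  exists s : nat -> C,
    (forall k, (1 <= k <= n)%nat -> Cmult (s k) (s k) = Cminus (fst p) (spiral k)) /\
    snd p = wsum eps s n.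

Definition wermer_set (eps : nat -> R) (b : C2) : Prop :=
  exists bs : nat -> C2, (forall n, (1 <= n)%nat -> E_n eps n (bs n)) /\ seq_cv2 bs b.

Definition continuous_on2 (V : C2 -> Prop) (phi : C2 -> R) : Prop :=
  forall p, V p -> forall e, 0 < e -> exists d, 0 < d /\
    forall q, V q -> dist2 p q < d -> Rabs (phi q - phi p) < e.

Definition usc_on2 (V : C2 -> Prop) (phi : C2 -> R) : Prop :=
  forall p, V p -> forall e, 0 < e -> exists d, 0 < d /\
    forall q, V q -> dist2 p q < d -> phi q < phi p + e.

Definition psh_on (V : C2 -> Prop) (phi : C2 -> R) : Prop :=
  usc_on2 V phi /\
  forall a b : C2, (forall z : C, Cmod z <= 1 -> V (c2_line a z b)) ->
    phi a <= / (2 * PI) * RInt (fun t => phi (c2_line a (cos t, sin t) b)) 0 (2 * PI).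

(* Main.v *)
Require Import Defs.
From Stdlib Require Import Reals ZArith Arith Lia Lra Psatz ClassicalEpsilon.
From Coquelicot Require Import Coquelicot.
Open Scope R_scope.

(** Take [eps_n = 4^-n].  The limit set consists of the points [(z, sum eps_k s_k)] with
    [s_k^2 = z - a_k] for all [k].  Joining two base points by a segment, choices of roots making
    an angle at most [pi/2] at every index continue one another, and the [k]-th root vanishes over
    [a_k], so going to [a_k] and back flips its sign: finitely many signs can be changed at will,
    which reaches a dense part of the limit set.  Over the unit disc around [a_k], the coordinate
    [zeta] with [z = a_k + zeta^2] parametrises holomorphic discs contained in the limit set.

    A continuous plurisubharmonic [phi] satisfies the maximum principle on such discs: doubling
    the variables with a quadratic penalty reduces it to the mean value inequality on tangent
    lines.  Comparison with a logarithm upgrades this to the strong maximum principle, so a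
    maximum propagates along continuations of roots.  Applied to [phi - delta ln |z|^2] on
    [|z| >= 3] this shows that [phi] attains its supremum, and applied to [phi] itself that [phi]
    equals this supremum on a dense subset of the limit set. *)

(** * The spiral enumerates the lattice *)

(** The ratio 1/4 is set against the crude bound |s_k| <= (2 + R) 2^k over |z| <= R: every choice of
    signs then leaves a tail of at most 2 (2 + R) / 2^n, and this one estimate underlies the
    convergence of [E_n], the closedness of the limit and the density argument. Uniformising discs
    exist everywhere because the lattice is evenly spaced: each z lies within 1/sqrt 2 of some a_k,
    while the open unit disc around a_k contains no second branch point, so one square-root
    coordinate makes all roots holomorphic together. Subharmonicity of [phi] on such a disc cannot
    be read off: [psh_on] speaks of complex lines and [phi] is merely continuous. Doubling the
    variables replaces smoothing followed by a chain rule. Continuation is encoded by an angle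
    condition instead of paths of roots. The condition passes to midpoints at all indices at once,
    so long segments reduce to short ones, and a vanishing root satisfies it with either sign, so
    segments through branch points need no special treatment. *)

Fixpoint seg_start (k : nat) : nat :=
  match k with O => O | S k' => (seg_start k' + seg_len k')%nat end.

Lemma seg_len_pos k : (1 <= seg_len k)%nat.
Proof. unfold seg_len; lia. Qed.

Lemma seg_start_ge k d : (seg_start k + d <= seg_start (k + d))%nat.
Proof.
  induction d as [|d IH].
  - rewrite !Nat.add_0_r; lia.
  - rewrite !Nat.add_succ_r; cbn [seg_start]. pose proof (seg_len_pos (k + d)); lia.
Qed.

(** Induction on the number [d] of segments still to be skipped; [j] counts steps from the start of
    segment [k], which itself moves in the recursion. *)
Lemma seg_of_spec d : forall fuel j k i, (d < fuel)%nat -> (i < seg_len (k + d))%nat ->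
  (j + seg_start k = seg_start (k + d) + i)%nat -> seg_of fuel j k = (k + d)%nat.
Proof.
  induction d as [|d IH]; intros fuel j k i Hf Hi Hj;
    destruct fuel as [|fuel]; try lia; cbn [seg_of].
  - rewrite Nat.add_0_r in *. destruct (Nat.ltb_spec j (seg_len k)); lia.
  - pose proof (seg_start_ge (S k) d) as Hs. cbn [seg_start] in Hs.
    replace (S k + d)%nat with (k + S d)%nat in Hs by lia.
    destruct (Nat.ltb_spec j (seg_len k)); [lia|].
    replace (k + S d)%nat with (S k + d)%nat in * by lia.
    apply IH with i; [lia|exact Hi|cbn [seg_start]; lia].
Qed.

Lemma step_dir_seg k i : (i < seg_len k)%nat -> step_dir (seg_start k + i) = spiral_dir k.
Proof.
  intros Hi. unfold step_dir. f_equal.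
  (* The fuel [S j] is enough because segments are nonempty, so at most [j] of them are skipped. *)
  apply (seg_of_spec k _ _ 0 i); simpl; try lia.
  pose proof (seg_start_ge 0 k); simpl in *; lia.
Qed.

Lemma spiral_pos_seg k x y dx dy i :
  spiral_pos (seg_start k) = (x, y) -> spiral_dir k = (dx, dy) -> (i <= seg_len k)%nat ->
  spiral_pos (seg_start k + i) = (x + Z.of_nat i * dx, y + Z.of_nat i * dy)%Z.
Proof.
  intros Hp Hd. induction i as [|i IH]; intros Hi.
  - rewrite Nat.add_0_r, Hp. f_equal; lia.
  - rewrite Nat.add_succ_r. cbn [spiral_pos].
    rewrite IH, step_dir_seg, Hd by lia. f_equal; lia.
Qed.

Lemma seg_params q r : (r < 4)%nat ->
  spiral_dir (4 * q + r) = spiral_dir r /\ seg_len (4 * q + r) = (2 * q + seg_len r)%nat.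
Proof.
  intros Hr. split.
  - unfold spiral_dir.
    replace ((4 * q + r) mod 4)%nat with (r mod 4)%nat; [reflexivity|].
    rewrite (Nat.mul_comm 4 q), Nat.add_comm, Nat.Div0.mod_add; reflexivity.
  - unfold seg_len.
    replace (4 * q + r)%nat with (r + (2 * q) * 2)%nat by lia.
    rewrite Nat.div_add by lia. lia.
Qed.

(** Four consecutive segments form one turn of the spiral. Turn [q] starts at (-q, -q); the default
    case is its end, which is the start of turn q + 1. *)
Definition corner (q : Z) (r : nat) : Z * Z :=
  match r with
  | O => (- q, - q)%Z
  | 1%nat => (q + 1, - q)%Z
  | 2%nat => (q + 1, q + 1)%Z
  | 3%nat => (- q - 1, q + 1)%Z
  | _ => (- q - 1, - q - 1)%Z
  end.

Lemma corner_next q r : (r < 4)%nat ->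
  spiral_pos (seg_start (4 * q + r)) = corner (Z.of_nat q) r ->
  spiral_pos (seg_start (4 * q + S r)) = corner (Z.of_nat q) (S r).
Proof.
  intros Hr H. destruct (seg_params q r Hr) as [Hd Hl].
  rewrite Nat.add_succ_r. cbn [seg_start].
  destruct r as [|[|[|[|r]]]]; try lia; cbn [corner] in *;
  (erewrite spiral_pos_seg; [|exact H|rewrite Hd; reflexivity|lia]; rewrite Hl;
   unfold seg_len; cbn [Nat.div Nat.divmod fst]; f_equal; lia).
Qed.

Lemma spiral_pos_corner q r : (r <= 4)%nat ->
  spiral_pos (seg_start (4 * q + r)) = corner (Z.of_nat q) r.
Proof.
  revert r. induction q as [|q IH]; intros r.
  - induction r as [|r IHr]; intros Hr; [reflexivity|].
    apply corner_next; [lia|]. apply IHr; lia.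
  - induction r as [|r IHr]; intros Hr.
    + replace (4 * S q + 0)%nat with (4 * q + 4)%nat by lia.
      rewrite IH by lia. cbn [corner]. f_equal; lia.
    + apply corner_next; [lia|]. apply IHr; lia.
Qed.

Lemma seg_decode j : exists k i, (i < seg_len k)%nat /\ j = (seg_start k + i)%nat.
Proof.
  induction j as [|j (k & i & Hi & Hj)].
  - exists 0%nat, 0%nat. unfold seg_len; simpl; lia.
  - destruct (Nat.eq_dec (S i) (seg_len k)) as [E|E].
    + exists (S k), 0%nat. pose proof (seg_len_pos (S k)). cbn [seg_start]; lia.
    + exists k, (S i). lia.
Qed.

Lemma spiral_pos_run q r i : (r < 4)%nat -> (i < 2 * q + seg_len r)%nat ->
  spiral_pos (seg_start (4 * q + r) + i) =
  (fst (corner (Z.of_nat q) r) + Z.of_nat i * fst (spiral_dir r),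
   snd (corner (Z.of_nat q) r) + Z.of_nat i * snd (spiral_dir r))%Z.
Proof.
  intros Hr Hi. destruct (seg_params q r Hr) as [Hd Hl].
  apply spiral_pos_seg.
  - rewrite spiral_pos_corner by lia. apply surjective_pairing.
  - rewrite Hd. apply surjective_pairing.
  - lia.
Qed.

Lemma seg_decode4 j : exists q r i, (r < 4)%nat /\ (i < 2 * q + seg_len r)%nat /\
  j = (seg_start (4 * q + r) + i)%nat.
Proof.
  destruct (seg_decode j) as (k & i & Hi & Hj).
  exists (k / 4)%nat, (k mod 4)%nat, i.
  pose proof (Nat.mod_upper_bound k 4 ltac:(lia)) as Hr.
  destruct (seg_params (k / 4) (k mod 4) Hr) as [_ Hl].
  rewrite <- Nat.div_mod_eq in *. lia.
Qed.

(** In terms of turn, side and offset, the claim is linear arithmetic for each of the sixteen pairs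
    of sides. *)
Lemma spiral_pos_inj j j' : spiral_pos j = spiral_pos j' -> j = j'.
Proof.
  destruct (seg_decode4 j) as (q & r & i & Hr & Hi & ->).
  destruct (seg_decode4 j') as (q' & r' & i' & Hr' & Hi' & ->).
  rewrite !spiral_pos_run by assumption. intros E.
  assert (q = q' /\ r = r' /\ i = i') as (-> & -> & ->); [|reflexivity].
  destruct r as [|[|[|[|r]]]]; try lia; destruct r' as [|[|[|[|r']]]]; try lia;
  unfold seg_len in Hi, Hi'; cbn in Hi, Hi', E; injection E; intros; lia.
Qed.

Lemma spiral_pos_surj x y : exists j, spiral_pos j = (x, y).
Proof.
  assert (H : exists q r i, (r < 4)%nat /\ (i < 2 * q + seg_len r)%nat /\
    (fst (corner (Z.of_nat q) r) + Z.of_nat i * fst (spiral_dir r),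
     snd (corner (Z.of_nat q) r) + Z.of_nat i * snd (spiral_dir r))%Z = (x, y)).
  (* The diagonals cut the lattice into four wedges, one for each side of the turns; the dominant
     coordinate determines the turn. *)
  { destruct (Z_le_gt_dec y 0) as [Hy|Hy].
    - destruct (Z_le_gt_dec y x) as [H1|H1]; [destruct (Z_le_gt_dec x (- y)) as [H2|H2]|].
      + exists (Z.to_nat (- y)), 0%nat, (Z.to_nat (x - y)).
        unfold seg_len; cbn; repeat split; try lia; f_equal; lia.
      + exists (Z.to_nat (x - 1)), 1%nat, (Z.to_nat (y + x - 1)).
        unfold seg_len; cbn; repeat split; try lia; f_equal; lia.
      + exists (Z.to_nat (- x - 1)), 3%nat, (Z.to_nat (- x - y)).
        unfold seg_len; cbn; repeat split; try lia; f_equal; lia.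
    - destruct (Z_le_gt_dec x y) as [H1|H1]; [destruct (Z_le_gt_dec (1 - y) x) as [H2|H2]|].
      + exists (Z.to_nat (y - 1)), 2%nat, (Z.to_nat (y - x)).
        unfold seg_len; cbn; repeat split; try lia; f_equal; lia.
      + exists (Z.to_nat (- x - 1)), 3%nat, (Z.to_nat (- x - y)).
        unfold seg_len; cbn; repeat split; try lia; f_equal; lia.
      + exists (Z.to_nat (x - 1)), 1%nat, (Z.to_nat (y + x - 1)).
        unfold seg_len; cbn; repeat split; try lia; f_equal; lia. }
  destruct H as (q & r & i & Hr & Hi & E).
  exists (seg_start (4 * q + r) + i)%nat. rewrite spiral_pos_run by assumption. exact E.
Qed.

Lemma spiral_pos_growth m :
  (Z.abs (fst (spiral_pos m)) + Z.abs (snd (spiral_pos m)) <= Z.of_nat m)%Z.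
Proof.
  induction m as [|m IH]; [simpl; lia|].
  cbn [spiral_pos].
  destruct (spiral_pos m) as [x y].
  assert (H : (Z.abs (fst (step_dir m)) + Z.abs (snd (step_dir m)) = 1)%Z).
  { unfold step_dir, spiral_dir.
    destruct (_ mod 4)%nat as [|[|[|]]]; reflexivity. }
  destruct (step_dir m) as [dx dy]. cbn [fst snd] in *. lia.
Qed.

(** Squared modulus, polynomial in the coordinates and so open to [ring] and [nra], unlike
    [Cmod]. *)
Definition N2 (z : C) : R := fst z * fst z + snd z * snd z.

Lemma spiral_sep j k : (1 <= j)%nat -> (1 <= k)%nat -> j <> k -> 1 <= N2 (spiral j - spiral k)%C.
Proof.
  intros Hj Hk Hjk. unfold spiral.
  assert (Hne : spiral_pos (j - 1) <> spiral_pos (k - 1)).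
  { intros E. apply spiral_pos_inj in E. lia. }
  destruct (spiral_pos (j - 1)) as [x y], (spiral_pos (k - 1)) as [x' y'].
  unfold N2; cbn. rewrite <- !opp_IZR, <- !plus_IZR, <- !mult_IZR, <- plus_IZR.
  apply IZR_le.
  assert (x + - x' <> 0 \/ y + - y' <> 0)%Z.
  { destruct (Z.eq_dec x x'), (Z.eq_dec y y'); subst; [now contradiction Hne|right; lia|left; lia|left; lia]. }
  generalize dependent (x + - x')%Z. generalize dependent (y + - y')%Z. intros b a H.
  assert (Hsq : forall c : Z, (c <> 0 -> 1 <= c * c)%Z) by (intros c; nia).
  pose proof (Z.square_nonneg a). pose proof (Z.square_nonneg b).
  destruct H as [H|H]; apply Hsq in H; lia.
Qed.

Lemma nearest_int x : exists n : Z, Rabs (x - IZR n) <= 1 / 2.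
Proof.
  destruct (archimed (x - 1 / 2)) as [H1 H2].
  exists (up (x - 1 / 2)). apply Rabs_le. lra.
Qed.

(** Rounding both coordinates. Since 1/sqrt 2 < 1, every point lies well inside the unit disc of
    some lattice point, with room for a smaller disc around it. *)
Lemma spiral_cover z : exists k, (1 <= k)%nat /\ N2 (z - spiral k)%C <= 1 / 2.
Proof.
  destruct z as [x y].
  destruct (nearest_int x) as [m Hm], (nearest_int y) as [n Hn].
  destruct (spiral_pos_surj m n) as [j Hj].
  exists (S j). split; [lia|]. unfold spiral.
  replace (S j - 1)%nat with j by lia. rewrite Hj. unfold N2; cbn.
  apply Rabs_le_between in Hm, Hn. nra.
Qed.

Lemma spiral_growth k : (1 <= k)%nat -> Cmod (spiral k) <= INR k.
Proof.
  intros Hk. unfold spiral. pose proof (spiral_pos_growth (k - 1)) as H.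
  destruct (spiral_pos (k - 1)) as [x y]. cbn [fst snd] in H.
  assert (Rabs (IZR x) + Rabs (IZR y) <= INR k).
  { rewrite <- !abs_IZR, <- plus_IZR, INR_IZR_INZ. apply IZR_le. lia. }
  apply Rle_trans with (2 := H0).
  unfold Cmod; cbn [fst snd].
  pose proof (Rabs_pos (IZR x)). pose proof (Rabs_pos (IZR y)).
  rewrite <- (sqrt_pow2 (Rabs (IZR x) + Rabs (IZR y))) by lra.
  apply sqrt_le_1_alt.
  rewrite <- (pow2_abs (IZR x)), <- (pow2_abs (IZR y)). nra.
Qed.

(** * Inner product and modulus of complex numbers *)

Definition cdot (a b : C) : R := fst a * fst b + snd a * snd b.

Lemma Cmod_sq z : Cmod z * Cmod z = N2 z.
Proof.
  unfold Cmod, N2. rewrite sqrt_sqrt; [ring|].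
  pose proof (pow2_ge_0 (fst z)). pose proof (pow2_ge_0 (snd z)). lra.
Qed.

Lemma N2_ge0 z : 0 <= N2 z.
Proof. unfold N2. nra. Qed.

Lemma N2_mult a b : N2 (a * b)%C = N2 a * N2 b.
Proof. unfold N2; cbn; ring. Qed.

Lemma N2_pos z : z <> RtoC 0 -> 0 < N2 z.
Proof.
  intros H. rewrite <- Cmod_sq. apply Cmod_gt_0 in H. nra.
Qed.

Lemma N2_le_Cmod z B : 0 <= B -> N2 z <= B * B -> Cmod z <= B.
Proof.
  intros HB H. rewrite <- Cmod_sq in H. pose proof (Cmod_ge_0 z). nra.
Qed.

Lemma N2_ge_Cmod z B : 0 <= B -> B * B <= N2 z -> B <= Cmod z.
Proof.
  intros HB H. rewrite <- Cmod_sq in H. pose proof (Cmod_ge_0 z). nra.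
Qed.

Lemma Rabs_fst_Cmod z : Rabs (fst z) <= Cmod z.
Proof. apply Rle_trans with (2 := Rmax_Cmod z). apply Rmax_l. Qed.

Lemma Rabs_snd_Cmod z : Rabs (snd z) <= Cmod z.
Proof. apply Rle_trans with (2 := Rmax_Cmod z). apply Rmax_r. Qed.

Lemma Cmod_le_sum z : Cmod z <= Rabs (fst z) + Rabs (snd z).
Proof.
  pose proof (Rabs_pos (fst z)). pose proof (Rabs_pos (snd z)).
  apply N2_le_Cmod; [lra|]. unfold N2.
  pose proof (pow2_abs (fst z)). pose proof (pow2_abs (snd z)). nra.
Qed.

Lemma Cmod_minus_sym a b : Cmod (a - b)%C = Cmod (b - a)%C.
Proof. rewrite <- Cmod_opp. f_equal. ring. Qed.

Lemma Cmod_triangle3 a b c : Cmod (a - c)%C <= Cmod (a - b)%C + Cmod (b - c)%C.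
Proof.
  replace (a - c)%C with ((a - b) + (b - c))%C by ring. apply Cmod_triangle.
Qed.

Lemma Cmod_sub_ge a b : Cmod a - Cmod b <= Cmod (a - b)%C.
Proof.
  pose proof (Cmod_triangle (a - b)%C b). replace (a - b + b)%C with a in H by ring. lra.
Qed.

(** * Square roots *)

(** Half-angle formulas give the moduli of the two coordinates; the sign of the imaginary part of
    [z] decides between the quadrants. *)
Definition csqrt (z : C) : C :=
  (sqrt ((Cmod z + fst z) / 2),
   if Rle_dec 0 (snd z) then sqrt ((Cmod z - fst z) / 2) else - sqrt ((Cmod z - fst z) / 2)).

Lemma csqrt_spec z : (csqrt z * csqrt z)%C = z.
Proof.
  destruct z as [x y]. pose proof (Rabs_fst_Cmod (x, y)) as H. cbn [fst] in H.
  apply Rabs_le_between in H. pose proof (Cmod_sq (x, y)) as Hm. unfold N2 in Hm.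
  cbn [fst snd] in Hm. unfold csqrt; cbn [fst snd]. set (m := Cmod (x, y)) in *.
  assert (H1 : 0 <= (m + x) / 2) by lra. assert (H2 : 0 <= (m - x) / 2) by lra.
  assert (Hp : sqrt ((m + x) / 2) * sqrt ((m - x) / 2) = Rabs y / 2).
  { rewrite <- sqrt_mult by assumption.
    replace ((m + x) / 2 * ((m - x) / 2)) with ((Rabs y / 2) ^ 2).
    - apply sqrt_pow2. pose proof (Rabs_pos y). lra.
    - unfold Rdiv. rewrite Rpow_mult_distr, pow2_abs. nra. }
  pose proof (sqrt_sqrt _ H1) as S1. pose proof (sqrt_sqrt _ H2) as S2.
  destruct (Rle_dec 0 y) as [Hy|Hy]; unfold Cmult; cbn [fst snd]; f_equal; try lra.
  - rewrite Rabs_pos_eq in Hp by assumption. lra.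
  - rewrite Rabs_left in Hp by lra. lra.
Qed.

(** The square root of [A] on the side of [ref]. No continuity in [A] is claimed; at a right angle
    the choice is arbitrary. *)
Definition rt (A ref : C) : C :=
  if Rle_dec 0 (cdot (csqrt A) ref) then csqrt A else (- csqrt A)%C.

Lemma rt_sq A ref : (rt A ref * rt A ref)%C = A.
Proof.
  unfold rt. destruct (Rle_dec _ _).
  - apply csqrt_spec.
  - rewrite <- (csqrt_spec A) at 3. ring.
Qed.

Lemma rt_dot A ref : 0 <= cdot (rt A ref) ref.
Proof.
  unfold rt. destruct (Rle_dec _ _) as [H|H]; [exact H|].
  unfold cdot in *; cbn in *; lra.
Qed.

Lemma sq_eq_pm (a b : C) : (a * a = b * b)%C -> a = b \/ a = (- b)%C.
Proof.
  intros H. assert (H0 : ((a - b) * (a + b) = 0)%C).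
  { replace ((a - b) * (a + b))%C with (a * a - b * b)%C by ring. rewrite H. ring. }
  destruct (Ceq_dec (a - b)%C (RtoC 0)) as [E|E].
  - left. replace a with (a - b + b)%C by ring. rewrite E. ring.
  - right. destruct (Ceq_dec (a + b)%C (RtoC 0)) as [E'|E'].
    + replace a with (a + b - b)%C by ring. rewrite E'. ring.
    + exfalso. exact (Cmult_neq_0 _ _ E E' H0).
Qed.

(* Writing [s = p + q], [s' = p - q], the hypothesis says [|q| <= |p|], the mean of the squares
   is [p^2 + q^2], and the root [m] on the side of [p] satisfies
   [2 (Re(m conj p)^2 - Re(m conj q)^2) = |m|^2 (|p|^2 - |q|^2) + |p|^4 - |q|^4]. *)
Lemma root_midpoint (s s' m : C) : 0 <= cdot s s' -> (2 * (m * m) = s * s + s' * s')%C ->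
  0 <= cdot m (s + s') -> 0 <= cdot m s /\ 0 <= cdot m s'.
Proof.
  intros H Hm Hd. destruct s as [a b], s' as [c d], m as [x y].
  unfold cdot in *; cbn in *. injection Hm; intros E2 E1.
  set (P := x * (a + c) + y * (b + d)) in *.
  set (Q := x * (a - c) + y * (b - d)).
  assert (HPQ : Q * Q <= P * P).
  { assert (P * P - Q * Q = 4 * ((x * a + y * b) * (x * c + y * d))) by (unfold P, Q; ring).
    assert (2 * ((x * a + y * b) * (x * c + y * d)) =
      (x * x + y * y) * (a * c + b * d) + (x * x - y * y) * (a * c - b * d) +
      (2 * x * y) * (a * d + b * c)) by ring.
    assert (E1' : x * x - y * y = (a * a - b * b + (c * c - d * d)) / 2) by lra.
    assert (E2' : 2 * x * y = (2 * a * b + 2 * c * d) / 2) by lra.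
    rewrite E1', E2' in H1.
    assert ((a * a - b * b + (c * c - d * d)) / 2 * (a * c - b * d) +
      (2 * a * b + 2 * c * d) / 2 * (a * d + b * c) =
      (a * c + b * d) * (a * a + b * b + c * c + d * d) / 2) by field.
    nra. }
  assert (HQ : - P <= Q <= P) by nra.
  unfold P, Q in HQ. lra.
Qed.

(** At an angle of at most pi/2 one has |s - s'| <= |s + s'|. This makes roots 1/2-Hölder with
    constant 1, even at the branch point. *)
Lemma root_dist (s s' : C) : 0 <= cdot s s' ->
  Cmod (s - s')%C * Cmod (s - s')%C <= Cmod (s * s - s' * s')%C.
Proof.
  intros H. replace (s * s - s' * s')%C with ((s - s') * (s + s'))%C by ring.
  rewrite Cmod_mult. apply Rmult_le_compat_l; [apply Cmod_ge_0|].
  apply N2_le_Cmod; [apply Cmod_ge_0|]. rewrite Cmod_sq.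
  unfold N2, cdot in *; cbn in *. nra.
Qed.

(** * Subsequences and compactness *)

Definition mono (s : nat -> nat) : Prop := forall n, (s n < s (S n))%nat.

Lemma mono_ge s : mono s -> forall n, (n <= s n)%nat.
Proof. intros H; induction n; [lia|]. specialize (H n); lia. Qed.

Lemma mono_lt s : mono s -> forall n m, (n < m)%nat -> (s n < s m)%nat.
Proof.
  intros H n m Hnm. induction Hnm as [|m Hnm IH]; [apply H|].
  specialize (H m); lia.
Qed.

Lemma mono_comp s t : mono s -> mono t -> mono (fun n => s (t n)).
Proof. intros Hs Ht n. apply (mono_lt s Hs). apply Ht. Qed.

Lemma subseq_extract (P : nat -> nat -> Prop) :
  (forall N n, exists p, (N <= p)%nat /\ P n p) -> exists s, mono s /\ forall n, P n (s n).
Proof.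
  intros H.
  pose (f := fun N n => proj1_sig (constructive_indefinite_description _ (H N n))).
  assert (Hf : forall N n, (N <= f N n)%nat /\ P n (f N n)).
  { intros N n. exact (proj2_sig (constructive_indefinite_description _ (H N n))). }
  pose (s := fix s n := match n with O => f O O | S m => f (S (s m)) (S m) end).
  exists s. split.
  - intros n. cbn. destruct (Hf (S (s n)) (S n)); lia.
  - intros [|n]; cbn; apply Hf.
Qed.

Lemma inv_INR_pos n : 0 < / (INR n + 1).
Proof. apply Rinv_0_lt_compat. pose proof (pos_INR n); lra. Qed.

Lemma inv_INR_small e : 0 < e -> exists N, forall n, (N <= n)%nat -> / (INR n + 1) < e.
Proof.
  intros He. destruct (archimed_cor1 e He) as (N & HN & HN0).
  exists N. intros n Hn. apply Rle_lt_trans with (2 := HN).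
  apply Rinv_le_contravar; [apply lt_0_INR; lia|]. apply le_INR in Hn. lra.
Qed.

Lemma bounded_subseq_R (u : nat -> R) B : (forall n, Rabs (u n) <= B) ->
  exists s l, mono s /\ Un_cv (fun n => u (s n)) l.
Proof.
  intros HB.
  destruct (Bolzano_Weierstrass u (fun c => - B <= c <= B)) as [l Hl].
  - apply compact_P3.
  - intros n. apply Rabs_le_between, HB.
  - destruct (subseq_extract (fun n p => Rabs (u p - l) < / (INR n + 1))) as (s & Hs & Hc).
    + intros N n. destruct (Hl (disc l (mkposreal _ (inv_INR_pos n))) N) as (p & Hp & Hd).
      * exists (mkposreal _ (inv_INR_pos n)). intros x Hx; exact Hx.
      * exists p. split; [exact Hp|exact Hd].
    + exists s, l. split; [exact Hs|]. intros e He.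
      destruct (inv_INR_small e He) as [N HN]. exists N. intros n Hn. unfold R_dist.
      apply Rlt_trans with (1 := Hc n). apply HN; lia.
Qed.

Lemma diagonal_subseq (u : nat -> nat -> R) : (forall j, exists B, forall n, Rabs (u n j) <= B) ->
  exists s, mono s /\ forall j, exists l, Un_cv (fun n => u (s n) j) l.
Proof.
  intros HB.
  assert (H1 : forall (sg : nat -> nat) j,
    exists t, mono t /\ exists l, Un_cv (fun n => u (sg (t n)) j) l).
  { intros sg j. destruct (HB j) as [B HBj].
    destruct (bounded_subseq_R (fun n => u (sg n) j) B) as (t & l & Ht & Hl).
    - intros n; apply HBj.
    - exists t; split; [exact Ht|exists l; exact Hl]. }
  pose (T := fun sg j => proj1_sig (constructive_indefinite_description _ (H1 sg j))).
  assert (HT : forall sg j, mono (T sg j) /\ exists l, Un_cv (fun n => u (sg (T sg j n)) j) l).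
  { intros sg j. exact (proj2_sig (constructive_indefinite_description _ (H1 sg j))). }
  pose (sg := fix sg j := match j with
              | O => fun n : nat => n
              | S i => fun n => sg i (T (sg i) i n) end).
  assert (Hsg : forall j, mono (sg j)).
  { induction j as [|j IH]; [intros n; cbn; lia|].
    exact (mono_comp _ _ IH (proj1 (HT (sg j) j))). }
  assert (Hnest : forall j d, exists r, mono r /\ forall n, sg (j + d)%nat n = sg j (r n)).
  { intros j d. induction d as [|d (r & Hr & IH)].
    - exists (fun n => n). split; [intros n; lia|]. intros n. rewrite Nat.add_0_r. reflexivity.
    - exists (fun n => r (T (sg (j + d)%nat) (j + d)%nat n)). split.
      + exact (mono_comp _ _ Hr (proj1 (HT _ _))).
      + intros n. rewrite Nat.add_succ_r. cbn [sg]. apply IH. }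
  (* From index [j] on, this diagonal runs inside level [S j], along which coordinate [j]
     converges. *)
  exists (fun n => sg (S n) n). split.
  - intros n.
    change (sg (S (S n)) (S n)) with (sg (S n) (T (sg (S n)) (S n) (S n))).
    apply mono_lt; [apply Hsg|].
    pose proof (mono_ge _ (proj1 (HT (sg (S n)) (S n))) (S n)). lia.
  - intros j. destruct (HT (sg j) j) as [_ [l Hl]]. exists l.
    intros e He. destruct (Hl e He) as [N HN]. exists (max N j). intros n Hn.
    destruct (Hnest (S j) (n - j)%nat) as (r & Hr & Hrn).
    replace (S n) with (S j + (n - j))%nat by lia. rewrite Hrn. cbn [sg].
    apply HN. pose proof (mono_ge _ Hr n). lia.
Qed.

(** * Convergence of complex sequences and attained maxima *)

Definition cv_C (x : nat -> C) (l : C) : Prop :=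
  forall e, 0 < e -> exists N, forall n, (N <= n)%nat -> Cmod (x n - l)%C < e.

Lemma cv_C_coord (x : nat -> C) (a b : R) :
  Un_cv (fun n => fst (x n)) a -> Un_cv (fun n => snd (x n)) b -> cv_C x (a, b).
Proof.
  intros Ha Hb e He.
  destruct (Ha (e / 2) ltac:(lra)) as [N1 H1]. destruct (Hb (e / 2) ltac:(lra)) as [N2' H2].
  exists (max N1 N2'). intros n Hn.
  apply Rle_lt_trans with (1 := Cmod_le_sum _).
  specialize (H1 n ltac:(lia)). specialize (H2 n ltac:(lia)). unfold R_dist in *.
  destruct (x n) as [p q]. cbn in *. unfold Rminus in *. lra.
Qed.

Lemma bounded_subseq (u : nat -> nat -> C) : (forall j, exists B, forall n, Cmod (u n j) <= B) ->
  exists s l, mono s /\ forall j, cv_C (fun n => u (s n) j) (l j).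
Proof.
  intros HB.
  (* Even coordinates hold real parts and odd ones imaginary parts, so a single real extraction
     treats all complex coordinates. *)
  destruct (diagonal_subseq (fun n i => if Nat.even i then fst (u n (Nat.div2 i))
    else snd (u n (Nat.div2 i)))) as (s & Hs & Hc).
  - intros i. destruct (HB (Nat.div2 i)) as [B H]. exists B. intros n.
    apply Rle_trans with (2 := H n).
    destruct (Nat.even i); [apply Rabs_fst_Cmod|apply Rabs_snd_Cmod].
  - assert (H : forall j, exists l, cv_C (fun n => u (s n) j) l).
    { intros j. destruct (Hc (2 * j)%nat) as [a Ha]. destruct (Hc (S (2 * j))) as [b Hb].
      exists (a, b).
      assert (E1 : Nat.even (2 * j) = true) by (rewrite Nat.even_mul; reflexivity).
      assert (E2 : Nat.even (S (2 * j)) = false)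
        by (rewrite Nat.even_succ, <- Nat.negb_even, E1; reflexivity).
      rewrite E1, Nat.div2_double in Ha. rewrite E2, Nat.div2_succ_double in Hb.
      apply cv_C_coord; assumption. }
    exists s, (fun j => proj1_sig (constructive_indefinite_description _ (H j))).
    split; [exact Hs|]. intros j.
    exact (proj2_sig (constructive_indefinite_description _ (H j))).
Qed.

Lemma cv_C_sub x l s : mono s -> cv_C x l -> cv_C (fun n => x (s n)) l.
Proof.
  intros Hs H e He. destruct (H e He) as [N HN]. exists N. intros n Hn.
  apply HN. pose proof (mono_ge s Hs n). lia.
Qed.

Lemma cv_C_unique x l l' : cv_C x l -> cv_C x l' -> l = l'.
Proof.
  intros H H'. destruct (Ceq_dec (l - l')%C (RtoC 0)) as [E|E].
  - replace l with (l - l' + l')%C by ring. rewrite E. ring.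
  - exfalso. apply Cmod_gt_0 in E.
    destruct (H (Cmod (l - l') / 2)%R ltac:(lra)) as [N HN].
    destruct (H' (Cmod (l - l') / 2)%R ltac:(lra)) as [N' HN'].
    specialize (HN (max N N') ltac:(lia)). specialize (HN' (max N N') ltac:(lia)).
    pose proof (Cmod_triangle3 l (x (max N N')) l') as Ht.
    rewrite (Cmod_minus_sym l (x _)) in Ht. lra.
Qed.

Lemma cv_C_le x l c B : cv_C x l -> (forall n, Cmod (x n - c)%C <= B) -> Cmod (l - c)%C <= B.
Proof.
  intros H HB. apply Rnot_lt_le. intros Hlt.
  destruct (H (Cmod (l - c) - B)%R ltac:(lra)) as [N HN].
  specialize (HN N ltac:(lia)). specialize (HB N).
  pose proof (Cmod_triangle3 l (x N) c) as Ht. rewrite (Cmod_minus_sym l (x N)) in Ht. lra.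
Qed.

Lemma cv_C_ge x l c B : cv_C x l -> (forall n, B <= Cmod (x n - c)%C) -> B <= Cmod (l - c)%C.
Proof.
  intros H HB. apply Rnot_lt_le. intros Hlt.
  destruct (H (B - Cmod (l - c))%R ltac:(lra)) as [N HN].
  specialize (HN N ltac:(lia)). specialize (HB N).
  pose proof (Cmod_triangle3 (x N) l c) as Ht. lra.
Qed.

Lemma cv_C_bounded x l : cv_C x l -> exists B, 0 <= B /\ forall n, Cmod (x n) <= B.
Proof.
  intros H. destruct (H 1 ltac:(lra)) as [N HN].
  assert (Hf : forall M, exists B, 0 <= B /\ forall n, (n < M)%nat -> Cmod (x n) <= B).
  { induction M as [|M (B & HB & IH)]; [exists 0; split; [lra|intros; lia]|].
    exists (Rmax B (Cmod (x M))). split; [apply Rle_trans with (1 := HB), Rmax_l|].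
    intros n Hn. destruct (Nat.eq_dec n M) as [->|]; [apply Rmax_r|].
    apply Rle_trans with (2 := Rmax_l _ _). apply IH; lia. }
  destruct (Hf N) as (B & HB & HBn).
  exists (Rmax B (Cmod l + 1)). split; [apply Rle_trans with (1 := HB), Rmax_l|].
  intros n. destruct (Nat.lt_ge_cases n N) as [Hn|Hn].
  - apply Rle_trans with (2 := Rmax_l _ _). apply HBn, Hn.
  - apply Rle_trans with (2 := Rmax_r _ _). specialize (HN n Hn).
    pose proof (Cmod_sub_ge (x n) l). lra.
Qed.

Lemma cv_C_mult x y l m : cv_C x l -> cv_C y m -> cv_C (fun n => x n * y n)%C (l * m)%C.
Proof.
  intros Hx Hy e He. destruct (cv_C_bounded x l Hx) as (B & HB & HBx).
  pose proof (Cmod_ge_0 m) as Hm.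
  assert (Hd : 0 < e / (2 * (B + 1)) /\ 0 < e / (2 * (Cmod m + 1))).
  { split; apply Rdiv_lt_0_compat; lra. }
  destruct (Hx _ (proj2 Hd)) as [N1 H1]. destruct (Hy _ (proj1 Hd)) as [N2' H2].
  exists (max N1 N2'). intros n Hn. specialize (H1 n ltac:(lia)). specialize (H2 n ltac:(lia)).
  replace (x n * y n - l * m)%C with (x n * (y n - m) + (x n - l) * m)%C by ring.
  apply Rle_lt_trans with (1 := Cmod_triangle _ _). rewrite !Cmod_mult.
  specialize (HBx n). pose proof (Cmod_ge_0 (x n)). pose proof (Cmod_ge_0 (y n - m)%C).
  pose proof (Cmod_ge_0 (x n - l)%C).
  assert (Cmod (x n) * Cmod (y n - m) <= (B + 1) * (e / (2 * (B + 1))))%R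
    by (apply Rmult_le_compat; lra).
  assert (Cmod (x n - l) * Cmod m <= e / (2 * (Cmod m + 1)) * Cmod m)%R
    by (apply Rmult_le_compat_r; lra).
  assert ((B + 1) * (e / (2 * (B + 1))) = e / 2)%R by (field; lra).
  assert (e / (2 * (Cmod m + 1)) * Cmod m < e / 2)%R.
  { replace (e / 2)%R with (e / (2 * (Cmod m + 1)) * (Cmod m + 1))%R by (field; lra).
    apply Rmult_lt_compat_l; lra. }
  lra.
Qed.

Lemma cv_C_minus_const x l c : cv_C x l -> cv_C (fun n => x n - c)%C (l - c)%C.
Proof.
  intros H e He. destruct (H e He) as [N HN]. exists N. intros n Hn.
  replace (x n - c - (l - c))%C with (x n - l)%C by ring. apply HN, Hn.
Qed.

(* Only the upper semicontinuity of [G] along the extracted subsequence is used. *)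
Lemma attain_max (T : Type) (S : T -> Prop) (G : T -> R) : (exists x, S x) ->
  (forall x : nat -> T, (forall n, S (x n)) -> exists s y, mono s /\ S y /\
     forall e, 0 < e -> exists N, forall n, (N <= n)%nat -> G (x (s n)) < G y + e) ->
  exists y, S y /\ forall x, S x -> G x <= G y.
Proof.
  intros [x0 Hx0] Hc.
  assert (Hb : bound (fun r => exists x, S x /\ r = G x)).
  { apply NNPP. intros Hnb.
    assert (H : forall n : nat, exists x, S x /\ INR n < G x).
    { intros n. apply NNPP. intros Hn. apply Hnb. exists (INR n). intros r (x & Hx & ->).
      apply Rnot_lt_le. intros Hlt. apply Hn. exists x; split; assumption. }
    pose (x := fun n => proj1_sig (constructive_indefinite_description _ (H n))).
    assert (Hx : forall n, S (x n) /\ INR n < G (x n))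
      by (intros n; exact (proj2_sig (constructive_indefinite_description _ (H n)))).
    destruct (Hc x (fun n => proj1 (Hx n))) as (s & y & Hs & _ & Hl).
    destruct (Hl 1 ltac:(lra)) as [N HN].
    destruct (INR_unbounded (G y + 1)) as [M HM].
    specialize (HN (max N M) ltac:(lia)).
    pose proof (proj2 (Hx (s (max N M)))) as H1.
    assert (INR M <= INR (s (max N M))).
    { apply le_INR. pose proof (mono_ge s Hs (max N M)). lia. }
    lra. }
  destruct (completeness _ Hb (ex_intro _ (G x0) (ex_intro _ x0 (conj Hx0 eq_refl))))
    as [L [HL1 HL2]].
  assert (H : forall n : nat, exists x, S x /\ L - / (INR n + 1) < G x).
  { intros n. apply NNPP. intros Hn. pose proof (inv_INR_pos n) as Hp.
    assert (L <= L - / (INR n + 1)); [|lra].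
    apply HL2. intros r (x & Hx & ->). apply Rnot_lt_le. intros Hlt. apply Hn.
    exists x; split; assumption. }
  pose (x := fun n => proj1_sig (constructive_indefinite_description _ (H n))).
  assert (Hx : forall n, S (x n) /\ L - / (INR n + 1) < G (x n))
    by (intros n; exact (proj2_sig (constructive_indefinite_description _ (H n)))).
  destruct (Hc x (fun n => proj1 (Hx n))) as (s & y & Hs & Hy & Hl).
  exists y. split; [exact Hy|]. intros t Ht.
  apply Rle_trans with L; [apply HL1; exists t; split; auto|].
  apply Rnot_lt_le. intros Hlt.
  destruct (Hl ((L - G y) / 2) ltac:(lra)) as [N HN].
  destruct (inv_INR_small ((L - G y) / 2) ltac:(lra)) as [M HM].
  specialize (HN (max N M) ltac:(lia)). pose proof (proj2 (Hx (s (max N M)))) as H1.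
  specialize (HM (s (max N M))). pose proof (mono_ge s Hs (max N M)).
  specialize (HM ltac:(lia)). lra.
Qed.

(** * The weighted sums *)

Definition weps (n : nat) : R := (/ 4) ^ n.

Lemma weps_pos n : 0 < weps n.
Proof. apply pow_lt; lra. Qed.

Lemma weps_decr n : weps (S n) < weps n.
Proof. pose proof (weps_pos n). unfold weps in *. cbn [pow]. lra. Qed.

Lemma weps_lim : is_lim_seq weps 0.
Proof. apply is_lim_seq_geom. rewrite Rabs_pos_eq; lra. Qed.

Definition tame (B : R) (s : nat -> C) : Prop := forall k, (1 <= k)%nat -> Cmod (s k) <= B * 2 ^ k.

(** The infinite weighted sum, one real coordinate at a time, shifted because roots are indexed from
    1. [Series] is total, so the value is meaningful where the series converge, which [tame]
    ensures. *)
Definition CS (s : nat -> C) : C :=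
  (Series (fun k => weps (S k) * fst (s (S k))), Series (fun k => weps (S k) * snd (s (S k)))).

Lemma half_pow_pos n : 0 < (/ 2) ^ n.
Proof. apply pow_lt; lra. Qed.

Lemma half_pow_small e : 0 < e -> exists N, forall n, (N <= n)%nat -> (/ 2) ^ n < e.
Proof.
  intros He. destruct (pow_lt_1_zero (/ 2) ltac:(rewrite Rabs_pos_eq; lra) e He) as [N HN].
  exists N. intros n Hn. specialize (HN n Hn).
  rewrite Rabs_pos_eq in HN; [exact HN|]. apply Rlt_le, half_pow_pos.
Qed.

Lemma scaled_half_pow_small B e : 0 < e ->
  exists N, forall n, (N <= n)%nat -> B * (/ 2) ^ n < e.
Proof.
  intros He. pose proof (Rabs_pos B). pose proof (Rle_abs B).
  destruct (half_pow_small (e / (Rabs B + 1))) as [N HN].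
  { apply Rdiv_lt_0_compat; lra. }
  exists N. intros n Hn. specialize (HN n Hn). pose proof (half_pow_pos n).
  apply Rle_lt_trans with ((Rabs B + 1) * (/ 2) ^ n); [apply Rmult_le_compat_r; lra|].
  replace e with ((Rabs B + 1) * (e / (Rabs B + 1))) by (field; lra).
  apply Rmult_lt_compat_l; lra.
Qed.

Lemma series_half_bound (a : nat -> R) B : (forall k, Rabs (a k) <= B * (/ 2) ^ (S k)) ->
  ex_series a /\ Rabs (Series a) <= B.
Proof.
  intros H.
  assert (Hq : Rabs (/ 2) < 1) by (rewrite Rabs_pos_eq; lra).
  assert (Hg : ex_series (fun k => B * (/ 2) ^ (S k))).
  { apply ex_series_ext with (fun k => scal (B * / 2) ((/ 2) ^ k)).
    - intros k. cbn. unfold scal; cbn; unfold mult; cbn; ring.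
    - apply (ex_series_scal (V := R_NormedModule)). exists (/ (1 - / 2)). apply is_series_geom, Hq. }
  assert (Ha : ex_series (fun k => Rabs (a k))).
  { apply (ex_series_le (fun k => Rabs (a k)) _) with (2 := Hg).
    intros k. change (norm (Rabs (a k))) with (Rabs (Rabs (a k))). rewrite Rabs_Rabsolu. apply H. }
  split.
  - apply (ex_series_Rabs a Ha).
  - apply Rle_trans with (1 := Series_Rabs a Ha).
    apply Rle_trans with (Series (fun k => B * (/ 2) ^ (S k))).
    + apply Series_le; [|exact Hg]. intros k. split; [apply Rabs_pos|apply H].
    + right. rewrite (Series_ext _ (fun k => (B * / 2) * (/ 2) ^ k)) by (intros k; cbn; ring).
      rewrite Series_scal_l, Series_geom by exact Hq. field.
Qed.

(** The partial sums enter through a recurrence, so that the coordinates of [wsum] can be used as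
    they are. *)
Lemma series_half_tail (a p : nat -> R) B : (forall k, Rabs (a k) <= B * (/ 2) ^ (S k)) ->
  p O = 0 -> (forall n, p (S n) = p n + a n) -> forall n, Rabs (Series a - p n) <= B * (/ 2) ^ n.
Proof.
  intros H Hp0 HpS n.
  assert (Hshift : forall m k, Rabs (a (m + k)%nat) <= B * (/ 2) ^ m * (/ 2) ^ (S k)).
  { intros m k. apply Rle_trans with (1 := H (m + k)%nat). right.
    replace (S (m + k)) with (m + S k)%nat by lia. rewrite pow_add. ring. }
  assert (E : Series a = p n + Series (fun k => a (n + k)%nat)).
  { induction n as [|n IH].
    - rewrite Hp0, Rplus_0_l. apply Series_ext. reflexivity.
    - rewrite IH, HpS, (Series_incr_1 (fun k => a (n + k)%nat)).
      + rewrite Nat.add_0_r, <- Rplus_assoc. f_equal. apply Series_ext.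
        intros k. f_equal. lia.
      + apply (series_half_bound _ _ (Hshift n)). }
  rewrite E. replace (p n + _ - p n) with (Series (fun k => a (n + k)%nat)) by ring.
  apply (series_half_bound _ _ (Hshift n)).
Qed.

Lemma weps_tame B s (p : C -> R) : (forall z, Rabs (p z) <= Cmod z) -> tame B s ->
  forall k, Rabs (weps (S k) * p (s (S k))) <= B * (/ 2) ^ (S k).
Proof.
  intros Hp Hs k. rewrite Rabs_mult, (Rabs_pos_eq (weps (S k))) by (apply Rlt_le, weps_pos).
  apply Rle_trans with (weps (S k) * (B * 2 ^ (S k))).
  - apply Rmult_le_compat_l; [apply Rlt_le, weps_pos|].
    apply Rle_trans with (1 := Hp _). apply Hs; lia.
  - right. unfold weps. replace (/ 4) with (/ 2 * / 2) by lra.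
    rewrite Rpow_mult_distr.
    assert (E : (/ 2) ^ S k * 2 ^ S k = 1).
    { rewrite <- Rpow_mult_distr. replace (/ 2 * 2) with 1 by lra. apply pow1. }
    replace (((/ 2) ^ S k * (/ 2) ^ S k) * (B * 2 ^ S k))
      with (B * (/ 2) ^ S k * ((/ 2) ^ S k * 2 ^ S k)) by ring.
    rewrite E. ring.
Qed.

(** The bound depends on [s] through [B] alone, hence is uniform over all choices of signs above a
    bounded set of base points. *)
Lemma CS_tail B s n : tame B s -> Cmod (CS s - wsum weps s n)%C <= 2 * B * (/ 2) ^ n.
Proof.
  intros Hs. apply Rle_trans with (1 := Cmod_le_sum _).
  pose proof (series_half_tail _ (fun n => fst (wsum weps s n)) B
    (weps_tame B s fst Rabs_fst_Cmod Hs) eq_refl) as H1.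
  pose proof (series_half_tail _ (fun n => snd (wsum weps s n)) B
    (weps_tame B s snd Rabs_snd_Cmod Hs) eq_refl) as H2.
  assert (E1 : forall n, fst (wsum weps s (S n)) = fst (wsum weps s n) + weps (S n) * fst (s (S n)))
    by (intros m; cbn; ring).
  assert (E2 : forall n, snd (wsum weps s (S n)) = snd (wsum weps s n) + weps (S n) * snd (s (S n)))
    by (intros m; cbn; ring).
  specialize (H1 E1 n). specialize (H2 E2 n).
  unfold CS. cbn [fst snd Cminus Cplus Copp] in *.
  unfold Rminus in *. lra.
Qed.

Lemma CS_bound B s : tame B s -> Cmod (CS s) <= 2 * B.
Proof.
  intros Hs. pose proof (CS_tail B s 0 Hs) as H. cbn [wsum pow] in H.
  replace (CS s - RtoC 0)%C with (CS s) in H by ring. lra.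
Qed.

Lemma le_half_pow_0 x B : (forall n, x <= B * (/ 2) ^ n) -> x <= 0.
Proof.
  intros H. apply Rnot_lt_le. intros Hx.
  destruct (scaled_half_pow_small B x Hx) as [N HN].
  specialize (H N). specialize (HN N (le_n _)). lra.
Qed.

(** Reduces identities for [CS] to [wsum], where they follow by finite induction. *)
Lemma CS_unique B s w : (forall n, Cmod (w - wsum weps s n)%C <= B * (/ 2) ^ n) ->
  forall B', tame B' s -> w = CS s.
Proof.
  intros Hw B' Hs.
  assert (H : Cmod (w - CS s)%C <= 0).
  { apply le_half_pow_0 with (B + 2 * B'). intros n.
    apply Rle_trans with (1 := Cmod_triangle3 _ (wsum weps s n) _).
    rewrite (Cmod_minus_sym (wsum weps s n)).
    pose proof (CS_tail B' s n Hs). specialize (Hw n). lra. }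
  assert (E : (w - CS s)%C = RtoC 0).
  { apply Cmod_eq_0. pose proof (Cmod_ge_0 (w - CS s)%C). lra. }
  replace w with (w - CS s + CS s)%C by ring. rewrite E. ring.
Qed.

Lemma wsum_lin s t c n :
  wsum weps (fun k => s k + c * t k)%C n = (wsum weps s n + c * wsum weps t n)%C.
Proof. induction n as [|n IH]; cbn [wsum]; [|rewrite IH]; ring. Qed.

Lemma tame_lin B B' s t c : tame B s -> tame B' t ->
  tame (B + Cmod c * B') (fun k => s k + c * t k)%C.
Proof.
  intros Hs Ht k Hk. apply Rle_trans with (1 := Cmod_triangle _ _).
  rewrite Cmod_mult. specialize (Hs k Hk). specialize (Ht k Hk).
  pose proof (Cmod_ge_0 c). nra.
Qed.

Lemma CS_lin B B' s t c : tame B s -> tame B' t ->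
  CS (fun k => s k + c * t k)%C = (CS s + c * CS t)%C.
Proof.
  intros Hs Ht. symmetry.
  apply (CS_unique (2 * B + Cmod c * (2 * B'))) with (2 := tame_lin _ _ _ _ c Hs Ht).
  intros n. rewrite wsum_lin.
  replace (CS s + c * CS t - (wsum weps s n + c * wsum weps t n))%C
    with ((CS s - wsum weps s n) + c * (CS t - wsum weps t n))%C by ring.
  apply Rle_trans with (1 := Cmod_triangle _ _). rewrite Cmod_mult.
  pose proof (CS_tail B s n Hs). pose proof (CS_tail B' t n Ht).
  pose proof (Cmod_ge_0 c). nra.
Qed.

Lemma CS_diff B s t : (exists Bs, tame Bs s) -> (exists Bt, tame Bt t) ->
  tame B (fun k => s k - t k)%C -> Cmod (CS s - CS t)%C <= 2 * B.
Proof.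
  intros [Bs Hs] [Bt Ht] H.
  replace (CS s - CS t)%C with (CS (fun k => s k + (- RtoC 1) * t k)%C).
  - apply CS_bound. intros k Hk.
    replace (s k + (- RtoC 1) * t k)%C with (s k - t k)%C by ring. apply H, Hk.
  - rewrite (CS_lin Bs Bt) by assumption. ring.
Qed.

Lemma wsum_ext s t n : (forall k, (1 <= k <= n)%nat -> s k = t k) ->
  wsum weps s n = wsum weps t n.
Proof.
  induction n as [|n IH]; intros H; [reflexivity|]. cbn [wsum].
  rewrite IH, (H (S n)) by (intros; try apply H; lia). reflexivity.
Qed.

Lemma cv_wsum (s : nat -> nat -> C) l n : (forall j, cv_C (fun m => s m j) (l j)) ->
  cv_C (fun m => wsum weps (s m) n) (wsum weps l n).
Proof.
  intros H. induction n as [|n IH]; intros e He.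
  - exists O. intros m _. cbn. replace (RtoC 0 - RtoC 0)%C with (RtoC 0) by ring.
    rewrite Cmod_0. exact He.
  - cbn [wsum]. destruct (IH (e / 2) ltac:(lra)) as [N1 H1].
    destruct (H (S n) (e / 2) ltac:(lra)) as [N2' H2].
    exists (max N1 N2'). intros m Hm. specialize (H1 m ltac:(lia)). specialize (H2 m ltac:(lia)).
    replace (wsum weps (s m) n + RtoC (weps (S n)) * s m (S n) -
      (wsum weps l n + RtoC (weps (S n)) * l (S n)))%C
      with ((wsum weps (s m) n - wsum weps l n) + RtoC (weps (S n)) * (s m (S n) - l (S n)))%C
      by ring.
    apply Rle_lt_trans with (1 := Cmod_triangle _ _). rewrite Cmod_mult, Cmod_R.
    assert (Rabs (weps (S n)) <= 1).
    { rewrite Rabs_pos_eq by (apply Rlt_le, weps_pos). unfold weps.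
      rewrite <- (pow1 (S n)). apply pow_incr. lra. }
    pose proof (Cmod_ge_0 (s m (S n) - l (S n))%C). pose proof (Rabs_pos (weps (S n))). nra.
Qed.

Lemma tame_limit B (s : nat -> nat -> C) l : (forall j, cv_C (fun m => s m j) (l j)) ->
  (forall m, tame B (s m)) -> tame B l.
Proof.
  intros H Hs k Hk. replace (l k) with (l k - RtoC 0)%C by ring.
  apply (cv_C_le _ _ _ _ (H k)). intros m.
  replace (s m k - RtoC 0)%C with (s m k) by ring. apply Hs, Hk.
Qed.

(** Dominated convergence: the common [B] makes all tails small at once, and a finite head converges
    term by term. *)
Lemma cv_CS B (s : nat -> nat -> C) l : (forall j, cv_C (fun m => s m j) (l j)) ->
  (forall m, tame B (s m)) -> cv_C (fun m => CS (s m)) (CS l).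
Proof.
  intros H Hs e He. pose proof (tame_limit B s l H Hs) as Hl.
  destruct (scaled_half_pow_small (2 * B) (e / 3) ltac:(lra)) as [n Hn].
  specialize (Hn n (le_n _)).
  destruct (cv_wsum s l n H (e / 3) ltac:(lra)) as [N HN].
  exists N. intros m Hm. specialize (HN m Hm).
  pose proof (CS_tail B (s m) n (Hs m)) as H1. pose proof (CS_tail B l n Hl) as H2.
  rewrite Cmod_minus_sym in H2.
  pose proof (Cmod_triangle3 (CS (s m)) (wsum weps (s m) n) (CS l)).
  pose proof (Cmod_triangle3 (wsum weps (s m) n) (wsum weps l n) (CS l)). lra.
Qed.

(** * The limit set as an image *)

Definition roots (s : nat -> C) (z : C) : Prop :=
  forall k, (1 <= k)%nat -> (s k * s k = z - spiral k)%C.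

Lemma roots_exist z : exists s, roots s z.
Proof. exists (fun k => csqrt (z - spiral k)). intros k _. apply csqrt_spec. Qed.

Lemma INR_pow2 k : INR k + 1 <= 2 ^ k.
Proof.
  induction k as [|k IH]; [cbn; lra|]. rewrite S_INR. cbn [pow].
  assert (1 <= 2 ^ k) by (apply pow_R1_Rle; lra). lra.
Qed.

Lemma root_Cmod s z k R0 : (1 <= k)%nat -> (s * s = z - spiral k)%C -> Cmod z <= R0 ->
  Cmod s <= (2 + R0) * 2 ^ k.
Proof.
  intros Hk Hs Hz.
  assert (H : Cmod s * Cmod s <= R0 + INR k).
  { rewrite <- Cmod_mult, Hs. apply Rle_trans with (1 := Cmod_triangle _ _).
    rewrite Cmod_opp. pose proof (spiral_growth k Hk). lra. }
  pose proof (INR_pow2 k). pose proof (pos_INR k). pose proof (Cmod_ge_0 s).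
  pose proof (Cmod_ge_0 z).
  (* From x <= 1 + x^2, which avoids a square root; the linear growth in [k] is then absorbed by
     2^k. *)
  assert (Cmod s <= 1 + (R0 + INR k)) by nra.
  assert (R0 * 1 <= R0 * 2 ^ k) by (apply Rmult_le_compat_l; lra). lra.
Qed.

Lemma roots_tame s z R0 : roots s z -> Cmod z <= R0 -> tame (2 + R0) s.
Proof. intros Hs Hz k Hk. apply (root_Cmod _ z); auto. Qed.

Lemma Cmod_fst_dist2 p q : Cmod (fst p - fst q)%C <= dist2 p q.
Proof.
  unfold dist2. rewrite <- (sqrt_pow2 (Cmod (fst p - fst q))) at 1 by apply Cmod_ge_0.
  apply sqrt_le_1_alt. pose proof (pow2_ge_0 (Cmod (snd p - snd q))). lra.
Qed.

Lemma Cmod_snd_dist2 p q : Cmod (snd p - snd q)%C <= dist2 p q.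
Proof.
  unfold dist2. rewrite <- (sqrt_pow2 (Cmod (snd p - snd q))) at 1 by apply Cmod_ge_0.
  apply sqrt_le_1_alt. pose proof (pow2_ge_0 (Cmod (fst p - fst q))). lra.
Qed.

Lemma dist2_le_sum p q : dist2 p q <= Cmod (fst p - fst q)%C + Cmod (snd p - snd q)%C.
Proof.
  unfold dist2. pose proof (Cmod_ge_0 (fst p - fst q)%C). pose proof (Cmod_ge_0 (snd p - snd q)%C).
  rewrite <- (sqrt_pow2 (Cmod (fst p - fst q) + Cmod (snd p - snd q))) by lra.
  apply sqrt_le_1_alt. nra.
Qed.

Lemma dist2_same_fst z w w' : dist2 (z, w) (z, w') <= Cmod (w - w')%C.
Proof.
  apply Rle_trans with (1 := dist2_le_sum _ _). cbn [fst snd].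
  replace (z - z)%C with (RtoC 0) by ring. rewrite Cmod_0. lra.
Qed.

Lemma dist2_sym p q : dist2 p q = dist2 q p.
Proof.
  unfold dist2. rewrite (Cmod_minus_sym (fst p)), (Cmod_minus_sym (snd p)). reflexivity.
Qed.

Lemma roots_bounded_subseq (z : nat -> C) (s : nat -> nat -> C) R0 :
  (forall n, roots (s n) (z n)) -> (forall n, Cmod (z n) <= R0) ->
  exists sg zl sl, mono sg /\ roots sl zl /\ cv_C (fun n => z (sg n)) zl /\
    cv_C (fun n => CS (s (sg n))) (CS sl).
Proof.
  intros Hs Hz.
  (* Slot 0, free because roots start at index 1, carries the base points, so they converge along
     the same subsequence. *)
  pose (u := fun n j => match j with O => z n | S i => s n (S i) end).
  destruct (bounded_subseq u) as (sg & l & Hsg & Hl).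
  { intros [|j].
    - exists R0. exact Hz.
    - exists ((2 + R0) * 2 ^ (S j)). intros n. cbn [u].
      apply (root_Cmod _ (z n)); [lia| |apply Hz]. apply Hs; lia. }
  exists sg, (l O), l. split; [exact Hsg|]. split; [|split; [exact (Hl O)|]].
  - intros k Hk. apply (cv_C_unique (fun n => u (sg n) k * u (sg n) k)%C).
    + apply cv_C_mult; apply Hl.
    + intros e He. destruct (cv_C_minus_const _ _ (spiral k) (Hl O) e He) as [N HN].
      exists N. intros n Hn. specialize (HN n Hn). cbn [u] in HN.
      destruct k as [|k]; [lia|]. cbn [u]. rewrite (Hs (sg n)) by lia. exact HN.
  - apply (cv_CS (2 + R0) (fun n => u (sg n)) l Hl).
    intros m k Hk. destruct k as [|k]; [lia|]. cbn [u].
    apply (roots_tame _ _ _ (Hs (sg m)) (Hz (sg m))); lia.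
Qed.

(** Roots beyond index [n] can be supplied freely, so [E_n] and the limit set are both described by
    complete root sequences and differ by truncation. *)
Lemma E_n_roots n z w : E_n weps n (z, w) <-> exists s, roots s z /\ w = wsum weps s n.
Proof.
  split.
  - intros (s & Hs & Hw). cbn [fst snd] in *.
    exists (fun k => if le_dec k n then s k else csqrt (z - spiral k)). split.
    + intros k Hk. destruct (le_dec k n); [apply Hs; lia|apply csqrt_spec].
    + rewrite Hw. apply wsum_ext. intros k Hk. destruct (le_dec k n); [reflexivity|lia].
  - intros (s & Hs & Hw). exists s. split; [intros k Hk; apply Hs; lia|exact Hw].
Qed.

Lemma cv2_coord (b : nat -> C2) p : seq_cv2 b p ->
  cv_C (fun n => fst (b n)) (fst p) /\ cv_C (fun n => snd (b n)) (snd p).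
Proof.
  intros H. split; intros e He; destruct (H e He) as [N HN]; exists N; intros n Hn.
  - apply Rle_lt_trans with (1 := Cmod_fst_dist2 _ _). apply HN, Hn.
  - apply Rle_lt_trans with (1 := Cmod_snd_dist2 _ _). apply HN, Hn.
Qed.

Lemma coord_cv2 (b : nat -> C2) p :
  cv_C (fun n => fst (b n)) (fst p) -> cv_C (fun n => snd (b n)) (snd p) -> seq_cv2 b p.
Proof.
  intros H1 H2 e He. destruct (H1 (e / 2) ltac:(lra)) as [N HN].
  destruct (H2 (e / 2) ltac:(lra)) as [N' HN']. exists (max N N'). intros n Hn.
  apply Rle_lt_trans with (1 := dist2_le_sum _ _).
  specialize (HN n ltac:(lia)). specialize (HN' n ltac:(lia)). lra.
Qed.

Lemma wermer_roots s z : roots s z -> wermer_set weps (z, CS s).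
Proof.
  intros Hs. exists (fun n => (z, wsum weps s n)). split.
  - intros n _. apply E_n_roots. exists s. split; auto.
  - intros e He.
    destruct (scaled_half_pow_small (2 * (2 + Cmod z)) e He) as [N HN].
    exists N. intros n Hn. apply Rle_lt_trans with (1 := dist2_same_fst _ _ _).
    rewrite Cmod_minus_sym. apply Rle_lt_trans with (2 := HN n Hn).
    apply CS_tail, (roots_tame s z); [exact Hs|lra].
Qed.

(** The signs may jump with [n]; compactness provides a convergent choice along a subsequence, and
    uniqueness of limits identifies its sum with the given limit. *)
Lemma roots_limit (z : nat -> C) (s : nat -> nat -> C) p :
  (forall n, roots (s n) (z n)) -> seq_cv2 (fun n => (z n, CS (s n))) p ->
  exists t, roots t (fst p) /\ snd p = CS t.
Proof.
  intros Hs Hcv. destruct (cv2_coord _ _ Hcv) as [Hz Hw]. cbn [fst snd] in *.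
  destruct (cv_C_bounded _ _ Hz) as (R0 & HR0 & Hb).
  destruct (roots_bounded_subseq z s R0 Hs Hb) as (sg & zl & sl & Hsg & Hr & Hzl & Hwl).
  exists sl. split.
  - rewrite (cv_C_unique _ _ _ (cv_C_sub _ _ sg Hsg Hz) Hzl). exact Hr.
  - exact (cv_C_unique _ _ _ (cv_C_sub _ _ sg Hsg Hw) Hwl).
Qed.

Lemma wermer_set_roots p : wermer_set weps p -> exists s, roots s (fst p) /\ p = (fst p, CS s).
Proof.
  intros (bs & Hbs & Hcv).
  (* [wermer_set] says nothing about [bs 0], so any roots over its first coordinate are taken
     there. *)
  assert (H : forall n, exists s, roots s (fst (bs n)) /\ ((1 <= n)%nat -> snd (bs n) = wsum weps s n)).
  { intros n. destruct (Nat.eq_dec n 0) as [->|Hn].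
    - destruct (roots_exist (fst (bs O))) as [s Hs]. exists s. split; [exact Hs|lia].
    - specialize (Hbs n ltac:(lia)). rewrite (surjective_pairing (bs n)) in Hbs.
      apply E_n_roots in Hbs. destruct Hbs as (s & Hs & Hw). exists s. split; auto. }
  pose (s := fun n => proj1_sig (constructive_indefinite_description _ (H n))).
  assert (Hs : forall n, roots (s n) (fst (bs n)) /\ ((1 <= n)%nat -> snd (bs n) = wsum weps (s n) n))
    by (intros n; exact (proj2_sig (constructive_indefinite_description _ (H n)))).
  destruct (cv2_coord _ _ Hcv) as [Hz Hw].
  destruct (cv_C_bounded _ _ Hz) as (R0 & HR0 & Hb).
  destruct (roots_limit (fun n => fst (bs n)) s p (fun n => proj1 (Hs n))) as (t & Ht & E).
  (* Passing from partial to full sums costs a uniform tail, so the limit stays the same. *)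
  - apply coord_cv2; cbn [fst snd]; [exact Hz|]. intros e He.
    destruct (scaled_half_pow_small (2 * (2 + R0)) (e / 2) ltac:(lra)) as [N HN].
    destruct (Hw (e / 2) ltac:(lra)) as [N' HN']. exists (max (max N N') 1). intros n Hn.
    specialize (HN n ltac:(lia)). specialize (HN' n ltac:(lia)).
    rewrite (proj2 (Hs n)) in HN' by lia.
    pose proof (CS_tail (2 + R0) (s n) n (roots_tame _ _ _ (proj1 (Hs n)) (Hb n))).
    pose proof (Cmod_triangle3 (CS (s n)) (wsum weps (s n) n) (snd p)). lra.
  - exists t. split; [exact Ht|]. rewrite <- E. apply surjective_pairing.
Qed.

Lemma wermer_closed : closed2 (wermer_set weps).
Proof.
  intros p Hp.
  assert (H : forall n : nat, exists zs : C * (nat -> C), roots (snd zs) (fst zs) /\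
    dist2 p (fst zs, CS (snd zs)) < / (INR n + 1)).
  { intros n. destruct (Hp _ (inv_INR_pos n)) as (q & Hq & Hd).
    destruct (wermer_set_roots q Hq) as (s & Hs & E). exists (fst q, s). cbn [fst snd].
    rewrite <- E. split; assumption. }
  pose (x := fun n => proj1_sig (constructive_indefinite_description _ (H n))).
  assert (Hx : forall n, roots (snd (x n)) (fst (x n)) /\
    dist2 p (fst (x n), CS (snd (x n))) < / (INR n + 1))
    by (intros n; exact (proj2_sig (constructive_indefinite_description _ (H n)))).
  destruct (roots_limit (fun n => fst (x n)) (fun n => snd (x n)) p (fun n => proj1 (Hx n)))
    as (t & Ht & E).
  - intros e He. destruct (inv_INR_small e He) as [N HN]. exists N. intros n Hn.
    rewrite dist2_sym. apply Rlt_trans with (1 := proj2 (Hx n)). apply HN, Hn.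
  - rewrite (surjective_pairing p), E. apply wermer_roots, Ht.
Qed.

Lemma wermer_nonempty : exists p, wermer_set weps p.
Proof. destruct (roots_exist (RtoC 0)) as [s Hs]. exists (RtoC 0, CS s). apply wermer_roots, Hs. Qed.

Lemma wermer_unbounded : unbounded2 (wermer_set weps).
Proof.
  intros M. destruct (roots_exist (RtoC (Rabs M + 1))) as [s Hs].
  exists (RtoC (Rabs M + 1), CS s). split; [apply wermer_roots, Hs|].
  apply Rlt_le_trans with (2 := Cmod_fst_dist2 _ _). cbn [fst origin2].
  replace (RtoC 0 - RtoC (Rabs M + 1))%C with (- RtoC (Rabs M + 1))%C by ring.
  rewrite Cmod_opp, Cmod_R. pose proof (Rabs_pos M). pose proof (Rle_abs M).
  rewrite Rabs_pos_eq; lra.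
Qed.

Lemma compact2_bounded K : compact2 K -> exists R0, forall p, K p -> Cmod (fst p) <= R0.
Proof.
  intros HK. apply NNPP. intros Hn.
  assert (H : forall n : nat, exists p, K p /\ INR n < Cmod (fst p)).
  { intros n. apply NNPP. intros Hn'. apply Hn. exists (INR n). intros p Hp.
    apply Rnot_lt_le. intros Hlt. apply Hn'. exists p; split; assumption. }
  pose (x := fun n => proj1_sig (constructive_indefinite_description _ (H n))).
  assert (Hx : forall n, K (x n) /\ INR n < Cmod (fst (x n)))
    by (intros n; exact (proj2_sig (constructive_indefinite_description _ (H n)))).
  destruct (HK x (fun n => proj1 (Hx n))) as (s & p & Hs & _ & Hcv).
  destruct (cv2_coord _ _ Hcv) as [Hz _]. destruct (cv_C_bounded _ _ Hz) as (B & _ & HB).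
  destruct (INR_unbounded B) as [n Hn']. specialize (HB n).
  pose proof (proj2 (Hx (s n))) as H1. pose proof (le_INR _ _ (mono_ge s Hs n)). lra.
Qed.

(** The same roots give a point of each set over the same [z]; the two differ by a tail that is
    uniform over the bounded projection of [K]. *)
Lemma wermer_hausdorff : local_hausdorff_cv (E_n weps) (wermer_set weps).
Proof.
  intros K HK e He. destruct (compact2_bounded K HK) as [R0 HR0].
  destruct (scaled_half_pow_small (2 * (2 + R0)) e He) as [N HN].
  exists N. intros n Hn. specialize (HN n Hn). split.
  - intros [z w] Hp HE. apply E_n_roots in HE. destruct HE as (s & Hs & ->).
    exists (z, CS s). split; [apply wermer_roots, Hs|].
    apply Rle_lt_trans with (1 := dist2_same_fst _ _ _). rewrite Cmod_minus_sym.
    apply Rle_lt_trans with (2 := HN). apply CS_tail, (roots_tame s z); [exact Hs|].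
    apply (HR0 _ Hp).
  - intros [z w] Hp HE. destruct (wermer_set_roots _ HE) as (s & Hs & E). cbn [fst] in *.
    rewrite E. exists (z, wsum weps s n). split; [apply E_n_roots; exists s; auto|].
    apply Rle_lt_trans with (1 := dist2_same_fst _ _ _).
    apply Rle_lt_trans with (2 := HN). apply CS_tail, (roots_tame s z); [exact Hs|].
    apply (HR0 _ Hp).
Qed.

(** * Continuation of roots along segments *)

(* [s'] is a continuation of [s] along the segment joining the base points: at each index the
   two roots make an angle at most [pi/2]. *)
Definition linked (s s' : nat -> C) : Prop := forall k, (1 <= k)%nat -> 0 <= cdot (s k) (s' k).

Lemma cdot_sym a b : cdot a b = cdot b a.
Proof. unfold cdot; ring. Qed.

Lemma linked_exists s z : exists s', roots s' z /\ linked s s'.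
Proof.
  exists (fun k => rt (z - spiral k) (s k)). split; intros k _.
  - apply rt_sq.
  - rewrite cdot_sym. apply rt_dot.
Qed.

Lemma linked_midpoint s s' z z' : roots s z -> roots s' z' -> linked s s' ->
  exists m, roots m ((z + z') / 2)%C /\ linked s m /\ linked m s'.
Proof.
  intros Hs Hs' HL. exists (fun k => rt ((z + z') / 2 - spiral k) (s k + s' k)).
  assert (H : forall k, (1 <= k)%nat ->
    let m := rt ((z + z') / 2 - spiral k) (s k + s' k) in 0 <= cdot m (s k) /\ 0 <= cdot m (s' k)).
  { intros k Hk. apply root_midpoint.
    - apply HL, Hk.
    - rewrite rt_sq, (Hs k Hk), (Hs' k Hk). field.
    - apply rt_dot. }
  split; [intros k _; apply rt_sq|]. split; intros k Hk.
  - rewrite cdot_sym. apply H, Hk.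
  - apply H, Hk.
Qed.

(** Splitting a link at midpoints reduces any segment to pieces of length at most [r], so a property
    needs to be propagated over short links only. *)
Lemma linked_halving (Reg : C -> Prop) (Q : C -> (nat -> C) -> Prop) r :
  0 < r -> (forall z z', Reg z -> Reg z' -> Reg ((z + z') / 2)%C) ->
  (forall z s z' s', Reg z -> Reg z' -> roots s z -> roots s' z' -> linked s s' ->
     Cmod (z - z')%C <= r -> Q z s -> Q z' s') ->
  forall z s z' s', Reg z -> Reg z' -> roots s z -> roots s' z' -> linked s s' -> Q z s -> Q z' s'.
Proof.
  intros Hr Hmid Hloc.
  assert (H : forall n z s z' s', Reg z -> Reg z' -> roots s z -> roots s' z' -> linked s s' ->
    Cmod (z - z')%C <= r * 2 ^ n -> Q z s -> Q z' s').
  { assert (H2 : RtoC 2 <> RtoC 0) by (intros E; injection E; lra).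
    induction n as [|n IH]; intros z s z' s' Hz Hz' Hs Hs' HL Hd HQ.
    - apply (Hloc z s); auto. cbn in Hd. lra.
    - destruct (linked_midpoint s s' z z' Hs Hs' HL) as (m & Hm & HL1 & HL2).
      assert (Hd' : Cmod ((z - z') / 2)%C <= r * 2 ^ n).
      { rewrite Cmod_div by exact H2. rewrite Cmod_R, Rabs_pos_eq by lra. cbn [pow] in Hd. lra. }
      apply (IH ((z + z') / 2)%C m); auto.
      + replace ((z + z') / 2 - z')%C with ((z - z') / 2)%C by (field; exact H2). exact Hd'.
      + apply (IH z s); auto.
        replace (z - (z + z') / 2)%C with ((z - z') / 2)%C by (field; exact H2). exact Hd'. }
  intros z s z' s' Hz Hz' Hs Hs' HL.
  destruct (INR_unbounded (Cmod (z - z') / r)) as [n Hn].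
  apply (H n); auto. pose proof (INR_pow2 n).
  apply (Rmult_lt_compat_l r) in Hn; [|exact Hr].
  replace (r * (Cmod (z - z') / r))%R with (Cmod (z - z')) in Hn by (field; lra). nra.
Qed.

Lemma spiral_root_zero s k : (1 <= k)%nat -> roots s (spiral k) -> s k = RtoC 0.
Proof.
  intros Hk Hs. specialize (Hs k Hk). apply Cmod_eq_0.
  assert (H : Cmod (s k) * Cmod (s k) = 0).
  { rewrite <- Cmod_mult, Hs. replace (spiral k - spiral k)%C with (RtoC 0) by ring. apply Cmod_0. }
  nra.
Qed.

(* Continuing from [z] to [a_k] and back leaves the choice of the sign of the [k]-th root free,
   since that root vanishes over [a_k]. *)
Lemma linked_reach (Q : C -> (nat -> C) -> Prop) :
  (forall z s z' s', roots s z -> roots s' z' -> linked s s' -> Q z s -> Q z' s') ->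
  forall z s z' s' n, roots s z -> Q z s -> roots s' z' ->
  exists t, roots t z' /\ Q z' t /\ forall k, (1 <= k <= n)%nat -> t k = s' k.
Proof.
  intros HQ z s z' s' n Hs Hq Hs'. induction n as [|n (t & Ht & Hqt & IH)].
  - destruct (linked_exists s z') as (t & Ht & HL).
    exists t. split; [exact Ht|]. split; [apply (HQ z s); auto|lia].
  - exists (fun k => if Nat.eq_dec k (S n) then s' k else t k).
    assert (Hr : roots (fun k => if Nat.eq_dec k (S n) then s' k else t k) z').
    { intros k Hk. destruct (Nat.eq_dec k (S n)); [apply Hs', Hk|apply Ht, Hk]. }
    split; [exact Hr|]. split.
    + destruct (linked_exists t (spiral (S n))) as (m & Hm & HL).
      apply (HQ (spiral (S n)) m); auto.
      * intros k Hk. destruct (Nat.eq_dec k (S n)) as [->|_].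
        -- rewrite (spiral_root_zero m (S n) Hk Hm). unfold cdot; cbn; lra.
        -- rewrite cdot_sym. apply HL, Hk.
      * apply (HQ z' t); auto.
    + intros k Hk. destruct (Nat.eq_dec k (S n)); [reflexivity|]. apply IH; lia.
Qed.

Lemma CS_agree s t z n : roots s z -> roots t z -> (forall k, (1 <= k <= n)%nat -> t k = s k) ->
  Cmod (CS t - CS s)%C <= 4 * (2 + Cmod z) * (/ 2) ^ n.
Proof.
  intros Hs Ht H.
  pose proof (CS_tail _ s n (roots_tame s z _ Hs (Rle_refl _))) as H1.
  pose proof (CS_tail _ t n (roots_tame t z _ Ht (Rle_refl _))) as H2.
  rewrite (wsum_ext t s n H) in H2. rewrite Cmod_minus_sym in H1.
  pose proof (Cmod_triangle3 (CS t) (wsum weps s n) (CS s)). lra.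
Qed.

(** Finitely many roots can be prescribed at will and the remaining ones contribute little to the
    sum. *)
Lemma linked_dense (Q : C -> (nat -> C) -> Prop) :
  (forall z s z' s', roots s z -> roots s' z' -> linked s s' -> Q z s -> Q z' s') ->
  (exists z s, roots s z /\ Q z s) -> forall p e, wermer_set weps p -> 0 < e ->
  exists z t, roots t z /\ Q z t /\ dist2 p (z, CS t) < e.
Proof.
  intros HQ (z & s & Hs & Hq) p e Hp He.
  destruct (wermer_set_roots p Hp) as (s' & Hs' & ->). cbn [fst] in *.
  destruct (scaled_half_pow_small (4 * (2 + Cmod (fst p))) e He) as [n Hn].
  destruct (linked_reach Q HQ z s (fst p) s' n Hs Hq Hs') as (t & Ht & Hqt & E).
  exists (fst p), t. split; [exact Ht|]. split; [exact Hqt|].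
  apply Rle_lt_trans with (1 := dist2_same_fst _ _ _). rewrite Cmod_minus_sym.
  apply Rle_lt_trans with (2 := Hn n (le_n _)). apply CS_agree; assumption.
Qed.

Lemma linked_CS_dist s s' z z' R0 : roots s z -> roots s' z' -> linked s s' ->
  Cmod z <= R0 -> Cmod z' <= R0 ->
  Cmod (CS s - CS s')%C * Cmod (CS s - CS s')%C <= 4 * Cmod (z - z')%C.
Proof.
  intros Hs Hs' HL Hz Hz'.
  assert (H : Cmod (CS s - CS s')%C <= 2 * sqrt (Cmod (z - z'))).
  { apply CS_diff.
    - exists (2 + R0). apply (roots_tame s z); assumption.
    - exists (2 + R0). apply (roots_tame s' z'); assumption.
    - intros k Hk.
      apply Rle_trans with (sqrt (Cmod (z - z')) * 1).
      + rewrite Rmult_1_r. rewrite <- (sqrt_square (Cmod (s k - s' k))) by apply Cmod_ge_0.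
        apply sqrt_le_1_alt. apply Rle_trans with (1 := root_dist _ _ (HL k Hk)).
        rewrite (Hs k Hk), (Hs' k Hk).
        replace (z - spiral k - (z' - spiral k))%C with (z - z')%C by ring. lra.
      + apply Rmult_le_compat_l; [apply sqrt_pos|]. apply pow_R1_Rle; lra. }
  pose proof (sqrt_sqrt _ (Cmod_ge_0 (z - z')%C)). pose proof (Cmod_ge_0 (CS s - CS s')%C).
  pose proof (sqrt_pos (Cmod (z - z'))). nra.
Qed.

(** * Second-order upper bounds and plurisubharmonicity *)

Lemma dist2_line a xi b : dist2 a (c2_line a xi b) <= Cmod xi * (Cmod (fst b) + Cmod (snd b)).
Proof.
  apply Rle_trans with (1 := dist2_le_sum _ _). unfold c2_line. cbn [fst snd].
  replace (fst a - (fst a + xi * fst b))%C with (- (xi * fst b))%C by ring.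
  replace (snd a - (snd a + xi * snd b))%C with (- (xi * snd b))%C by ring.
  rewrite !Cmod_opp, !Cmod_mult. lra.
Qed.

Lemma dist2_line_line a x y b :
  dist2 (c2_line a x b) (c2_line a y b) <= Cmod (x - y)%C * (Cmod (fst b) + Cmod (snd b)).
Proof.
  apply Rle_trans with (1 := dist2_le_sum _ _). unfold c2_line. cbn [fst snd].
  replace (fst a + x * fst b - (fst a + y * fst b))%C with ((x - y) * fst b)%C by ring.
  replace (snd a + x * snd b - (snd a + y * snd b))%C with ((x - y) * snd b)%C by ring.
  rewrite !Cmod_mult. lra.
Qed.

Lemma Cmod_circle t : Cmod (cos t, sin t) = 1.
Proof.
  unfold Cmod. cbn [fst snd]. rewrite <- sqrt_1. f_equal.
  pose proof (sin2_cos2 t). unfold Rsqr in *. lra.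
Qed.

Lemma continuous_circle V phi a b t : continuous_on2 V phi ->
  (forall z, Cmod z <= 1 -> V (c2_line a z b)) ->
  continuous (fun t => phi (c2_line a (cos t, sin t) b)) t.
Proof.
  intros Hc HV.
  assert (HVt : forall t, V (c2_line a (cos t, sin t) b)).
  { intros u. apply HV. rewrite Cmod_circle. lra. }
  apply filterlim_locally. intros e.
  destruct (Hc _ (HVt t) e (cond_pos e)) as (d & Hd & H).
  set (B := Cmod (fst b) + Cmod (snd b)).
  assert (HB : 0 <= B) by (pose proof (Cmod_ge_0 (fst b)); pose proof (Cmod_ge_0 (snd b)); unfold B; lra).
  assert (Hd' : 0 < d / (2 * (B + 1))) by (apply Rdiv_lt_0_compat; lra).
  pose proof (proj1 (filterlim_locally _ _) (continuous_cos t) (mkposreal _ Hd')) as H1.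
  pose proof (proj1 (filterlim_locally _ _) (continuous_sin t) (mkposreal _ Hd')) as H2.
  generalize (filter_and _ _ H1 H2). apply filter_imp. intros u [Hu1 Hu2].
  change (Rabs (cos u - cos t) < d / (2 * (B + 1))) in Hu1.
  change (Rabs (sin u - sin t) < d / (2 * (B + 1))) in Hu2.
  apply H; [apply HVt|].
  apply Rle_lt_trans with (1 := dist2_line_line _ _ _ _). fold B.
  assert (Hm : Cmod ((cos t, sin t) - (cos u, sin u))%C < d / (B + 1)).
  { rewrite Cmod_minus_sym. apply Rle_lt_trans with (1 := Cmod_le_sum _). cbn [fst snd Cminus Cplus Copp].
    replace (d / (B + 1)) with (d / (2 * (B + 1)) + d / (2 * (B + 1))) by (field; lra).
    apply Rplus_lt_compat; assumption. }
  apply Rle_lt_trans with (d / (B + 1) * B).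
  - apply Rmult_le_compat_r; lra.
  - replace d with (d / (B + 1) * (B + 1)) at 2 by (field; lra).
    apply Rmult_lt_compat_l; [apply Rdiv_lt_0_compat; lra|lra].
Qed.

(** The integrand is k + Re(a e^(it) + b e^(2it)) with a = a1 + i a2 and b = b1 + i b2, so all but
    the constant averages out. *)
Lemma RInt_trig2 k a1 a2 b1 b2 :
  is_RInt (fun t => k + (a1 * cos t - a2 * sin t) +
    (b1 * (cos t * cos t - sin t * sin t) - b2 * (2 * (sin t * cos t)))) 0 (2 * PI) (2 * PI * k).
Proof.
  pose (Q := fun t => k * t + (a1 * sin t + a2 * cos t) + (b1 * (sin t * cos t) - b2 * (sin t * sin t))).
  replace (2 * PI * k) with (minus (Q (2 * PI)) (Q 0)).
  - apply (is_RInt_derive Q).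
    + intros t _. unfold Q. auto_derive; [exact I|ring].
    + intros t _. apply continuity_pt_filterlim. reg.
  - unfold Q, minus, plus, opp; cbn. rewrite sin_2PI, cos_2PI, sin_0, cos_0. ring.
Qed.

(** On a circle of radius r the harmonic terms average to zero, so the mean value inequality would
    yield 0 <= - eta r^2 + C0 r^3, which fails for small r. *)
Lemma psh_no_strict V phi a b al be C0 r0 eta : open2 V -> continuous_on2 V phi -> psh_on V phi ->
  V a -> 0 < r0 -> 0 < eta ->
  (forall xi, Cmod xi <= r0 ->
     phi (c2_line a xi b) <= phi a + fst (al * xi + be * (xi * xi))%C - eta * N2 xi + C0 * Cmod xi ^ 3) ->
  False.
Proof.
  intros HV Hc [_ Hpsh] Ha Hr0 Heta Hup.
  destruct (HV a Ha) as (r1 & Hr1 & Hball).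
  set (B := Cmod (fst b) + Cmod (snd b)).
  assert (HB : 0 <= B) by (pose proof (Cmod_ge_0 (fst b)); pose proof (Cmod_ge_0 (snd b)); unfold B; lra).
  pose proof (Rabs_pos C0) as HC0. pose proof (Rle_abs C0) as HC1.
  (* The three bounds keep the upper estimate valid, the disc inside [V], and C0 r below [eta]. *)
  pose (r := Rmin r0 (Rmin (r1 / (2 * (B + 1))) (eta / (2 * (Rabs C0 + 1))))).
  assert (Hr : 0 < r).
  { unfold r. repeat apply Rmin_pos; [assumption| |]; apply Rdiv_lt_0_compat; lra. }
  assert (Hrr0 : r <= r0) by apply Rmin_l.
  assert (Hrr1 : r * (2 * (B + 1)) <= r1).
  { apply Rle_trans with (r1 / (2 * (B + 1)) * (2 * (B + 1))); [|right; field; lra].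
    apply Rmult_le_compat_r; [lra|]. apply Rle_trans with (1 := Rmin_r _ _), Rmin_l. }
  assert (Hrr2 : r * (2 * (Rabs C0 + 1)) <= eta).
  { apply Rle_trans with (eta / (2 * (Rabs C0 + 1)) * (2 * (Rabs C0 + 1))); [|right; field; lra].
    apply Rmult_le_compat_r; [lra|]. apply Rle_trans with (1 := Rmin_r _ _), Rmin_r. }
  (* [psh_on] refers to the unit circle, so the radius is absorbed into the direction. *)
  pose (b' := (RtoC r * fst b, RtoC r * snd b)%C : C2).
  assert (Eline : forall z, c2_line a z b' = c2_line a (RtoC r * z)%C b).
  { intros z. unfold c2_line, b'. cbn [fst snd]. f_equal; ring. }
  assert (HVb : forall z, Cmod z <= 1 -> V (c2_line a z b')).
  { intros z Hz. rewrite Eline. apply Hball. apply Rle_lt_trans with (1 := dist2_line _ _ _). fold B.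
    rewrite Cmod_mult, Cmod_R, Rabs_pos_eq by lra. pose proof (Cmod_ge_0 z). nra. }
  specialize (Hpsh a b' HVb).
  pose (k := phi a + (C0 * r ^ 3 - eta * r ^ 2)).
  pose proof (RInt_trig2 k (r * fst al) (r * snd al) (r * r * fst be) (r * r * snd be)) as HI.
  assert (Hle : RInt (fun t => phi (c2_line a (cos t, sin t) b')) 0 (2 * PI) <= 2 * PI * k).
  { rewrite <- (is_RInt_unique _ _ _ _ HI). apply RInt_le.
    - pose proof PI_RGT_0; lra.
    - apply (ex_RInt_continuous (V := R_CompleteNormedModule)). intros t _.
      apply (continuous_circle V phi a b' t Hc HVb).
    - eexists; exact HI.
    - intros t _. rewrite Eline.
      assert (Hm : Cmod (RtoC r * (cos t, sin t))%C = r).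
      { rewrite Cmod_mult, Cmod_R, Rabs_pos_eq, Cmod_circle by lra. ring. }
      assert (Hn : N2 (RtoC r * (cos t, sin t))%C = r ^ 2).
      { rewrite <- Cmod_sq, Hm. ring. }
      specialize (Hup (RtoC r * (cos t, sin t))%C). rewrite Hm, Hn in Hup. specialize (Hup Hrr0).
      apply Rle_trans with (1 := Hup). right. unfold k. cbn. ring. }
  pose proof PI_RGT_0 as Hpi.
  assert (H : phi a <= k).
  { apply Rle_trans with (1 := Hpsh).
    apply Rle_trans with (/ (2 * PI) * (2 * PI * k)).
    - apply Rmult_le_compat_l; [|exact Hle]. apply Rlt_le, Rinv_0_lt_compat; lra.
    - right. field. lra. }
  unfold k in H.
  assert (C0 * r ^ 3 < eta * r ^ 2); [|lra].
  replace (C0 * r ^ 3) with (C0 * r * r ^ 2) by ring.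
  apply Rmult_lt_compat_r; [apply pow_lt, Hr|]. nra.
Qed.

(** A pointwise form of Laplacian <= 4 kap: an upper bound by a harmonic quadratic plus kap |xi|^2,
    up to third order. Negative [kap] expresses strict superharmonicity. *)
Definition subT (kap : R) (g : C -> R) (z : C) : Prop :=
  exists al be C0 r0, 0 < r0 /\ 0 <= C0 /\ forall xi, Cmod xi <= r0 ->
    g (z + xi)%C <= g z + fst (al * xi + be * (xi * xi))%C + kap * N2 xi + C0 * Cmod xi ^ 3.

Lemma subT_plus k1 k2 f g z : subT k1 f z -> subT k2 g z -> subT (k1 + k2) (fun x => f x + g x) z.
Proof.
  intros (a1 & b1 & C1 & r1 & Hr1 & HC1 & H1) (a2 & b2 & C2' & r2 & Hr2 & HC2 & H2).
  exists (a1 + a2)%C, (b1 + b2)%C, (C1 + C2'), (Rmin r1 r2).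
  split; [apply Rmin_pos; assumption|]. split; [lra|]. intros xi Hxi.
  specialize (H1 xi (Rle_trans _ _ _ Hxi (Rmin_l _ _))).
  specialize (H2 xi (Rle_trans _ _ _ Hxi (Rmin_r _ _))).
  replace ((a1 + a2) * xi + (b1 + b2) * (xi * xi))%C
    with ((a1 * xi + b1 * (xi * xi)) + (a2 * xi + b2 * (xi * xi)))%C by ring.
  change (fst ((a1 * xi + b1 * (xi * xi)) + (a2 * xi + b2 * (xi * xi)))%C)
    with (fst (a1 * xi + b1 * (xi * xi))%C + fst (a2 * xi + b2 * (xi * xi))%C). lra.
Qed.

Lemma subT_scal c k g z : 0 <= c -> subT k g z -> subT (c * k) (fun x => c * g x) z.
Proof.
  intros Hc (a & b & C0 & r0 & Hr0 & HC0 & H).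
  exists (RtoC c * a)%C, (RtoC c * b)%C, (c * C0), r0.
  split; [exact Hr0|]. split; [nra|]. intros xi Hxi. specialize (H xi Hxi).
  replace (fst (RtoC c * a * xi + RtoC c * b * (xi * xi))%C)
    with (c * fst (a * xi + b * (xi * xi))%C) by (cbn; ring).
  apply (Rmult_le_compat_l c) in H; [lra|exact Hc].
Qed.

Lemma subT_N2 eta c z : subT (- eta) (fun x => - eta * N2 (x - c)%C) z.
Proof.
  exists (RtoC (- (2 * eta)) * Cconj (z - c))%C, (RtoC 0), 0, 1.
  split; [lra|]. split; [lra|]. intros xi _. right. unfold N2. cbn. ring.
Qed.

Lemma ln_up X : -1 < X -> ln (1 + X) <= X - X ^ 2 / 2 + X ^ 3 / 3.
Proof.
  intros HX.
  (* Its derivative x^3 / (1 + x) has the sign of x, so the minimum is the value 0 at 0. *)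
  pose (g := fun X => X - X ^ 2 / 2 + X ^ 3 / 3 - ln (1 + X)).
  assert (Hd : forall x, -1 < x -> is_derive g x (x ^ 3 / (1 + x))).
  { intros x Hx. unfold g. auto_derive; [lra|]. field. lra. }
  destruct (MVT_gen g 0 X (fun x => x ^ 3 / (1 + x))) as (c & Hc & E).
  - intros x Hx. apply Hd. unfold Rmin in Hx. destruct (Rle_dec 0 X); lra.
  - intros x Hx. apply continuity_pt_filterlim. apply (ex_derive_continuous g).
    eexists. apply Hd. unfold Rmin in Hx. destruct (Rle_dec 0 X); lra.
  - assert (0 <= g X - g 0).
    { rewrite E. unfold Rmin, Rmax in Hc.
      assert (Hc1 : 0 < 1 + c) by (destruct (Rle_dec 0 X); lra).
      replace (c ^ 3 / (1 + c) * (X - 0)) with (c * c * / (1 + c) * (c * X)) by (field; lra).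
      apply Rmult_le_pos; [apply Rmult_le_pos; [nra|apply Rlt_le, Rinv_0_lt_compat; lra]|].
      destruct (Rle_dec 0 X); nra. }
    unfold g in H at 2. rewrite Rplus_0_r, ln_1 in H. unfold g in H. lra.
Qed.

(** Second-order expansion of 2 Re log(1 + w). For |w| <= 1/4 the number X in ln(1 + X) satisfies
    |X| <= 9/4 |w|, and (9/4)^3 / 3 + 2 < 6. *)
Lemma ln_N2_up w : Cmod w <= 1 / 4 ->
  ln (N2 (1 + w)%C) <= 2 * fst w - fst (w * w)%C + 6 * Cmod w ^ 3.
Proof.
  intros Hw. pose proof (Cmod_ge_0 w) as Hn. pose proof (Cmod_sq w) as Hsq.
  pose proof (Rabs_fst_Cmod w) as H1. apply Rabs_le_between in H1.
  set (n := Cmod w) in *. set (X := 2 * fst w + N2 w).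
  assert (EX : N2 (1 + w)%C = 1 + X) by (unfold X, N2; cbn; ring).
  assert (HX1 : - (9 / 4 * n) <= X <= 9 / 4 * n) by (unfold X; nra).
  rewrite EX. apply Rle_trans with (1 := ln_up X ltac:(lra)).
  assert (H3 : X ^ 3 <= (9 / 4 * n) ^ 3).
  { destruct (Rle_dec 0 X).
    - apply pow_incr. lra.
    - apply Rle_trans with 0; [|apply pow_le; lra].
      replace (X ^ 3) with (X * (X * X)) by ring. nra. }
  assert (E : X - X ^ 2 / 2 = 2 * fst w - fst (w * w)%C - 2 * fst w * N2 w - N2 w * N2 w / 2).
  { unfold X, N2. cbn. field. }
  rewrite E.
  assert (H4 : - 2 * fst w * N2 w <= 2 * n ^ 3).
  { rewrite <- Hsq. replace (2 * n ^ 3) with (2 * n * (n * n)) by ring.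
    apply Rmult_le_compat_r; nra. }
  assert (H5 : 0 <= N2 w * N2 w) by nra.
  assert (H6 : 0 <= n ^ 3) by (apply pow_le; lra).
  replace ((9 / 4 * n) ^ 3) with (729 / 64 * n ^ 3) in H3 by field. lra.
Qed.

Lemma fst_le_Cmod z : fst z <= Cmod z.
Proof. apply Rle_trans with (1 := Rle_abs _), Rabs_fst_Cmod. Qed.

(** Harmonicity of ln |P|^2 off the zeros of [P], reduced to ln |1 + w|^2 on division by [P z].
    Degree two covers both z - c and the chart coordinate a_k + zeta^2. *)
Lemma subT_ln (P : C -> C) z p1 p2 :
  (forall xi, P (z + xi)%C = (P z + p1 * xi + p2 * (xi * xi))%C) -> P z <> RtoC 0 ->
  subT 0 (fun x => ln (N2 (P x))) z.
Proof.
  intros HP H0. set (q1 := (p1 / P z)%C). set (q2 := (p2 / P z)%C).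
  pose proof (Cmod_ge_0 q1) as Hq1. pose proof (Cmod_ge_0 q2) as Hq2.
  set (B := Cmod q1 + Cmod q2).
  assert (HB : 0 <= B) by (unfold B; lra).
  exists (2 * q1)%C, (2 * q2 - q1 * q1)%C,
    (6 * B ^ 3 + (2 * (Cmod q1 * Cmod q2) + Cmod q2 * Cmod q2)), (Rmin 1 (/ (4 * (B + 1)))).
  assert (HB4 : 0 < / (4 * (B + 1))) by (apply Rinv_0_lt_compat; lra).
  split; [apply Rmin_pos; lra|]. split; [pose proof (pow_le B 3 HB); nra|].
  intros xi Hxi.
  assert (Hx1 : Cmod xi <= 1) by (apply Rle_trans with (1 := Hxi), Rmin_l).
  assert (Hx2 : Cmod xi * (4 * (B + 1)) <= 1).
  { apply Rle_trans with (/ (4 * (B + 1)) * (4 * (B + 1))); [|right; field; lra].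
    apply Rmult_le_compat_r; [lra|]. apply Rle_trans with (1 := Hxi), Rmin_r. }
  pose proof (Cmod_ge_0 xi) as Hx0.
  set (w := (q1 * xi + q2 * (xi * xi))%C).
  assert (Hw : Cmod w <= B * Cmod xi).
  { unfold w. apply Rle_trans with (1 := Cmod_triangle _ _). rewrite !Cmod_mult. unfold B.
    assert (Cmod q2 * (Cmod xi * Cmod xi) <= Cmod q2 * (1 * Cmod xi)).
    { apply Rmult_le_compat_l; [lra|]. apply Rmult_le_compat_r; lra. }
    lra. }
  assert (EP : P (z + xi)%C = (P z * (1 + w))%C).
  { rewrite HP. unfold w, q1, q2. field. exact H0. }
  assert (Hw4 : Cmod w <= 1 / 4) by nra.
  pose proof (ln_N2_up w Hw4) as Hln.
  assert (Hpos : 0 < N2 (1 + w)%C).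
  { apply N2_pos. intros E. assert (Ew : w = (- RtoC 1)%C).
    { replace w with (1 + w - 1)%C by ring. rewrite E. ring. }
    rewrite Ew, Cmod_opp, Cmod_1 in Hw4. lra. }
  rewrite EP, N2_mult, ln_mult by (exact Hpos || apply N2_pos, H0).
  assert (Hw3 : Cmod w ^ 3 <= B ^ 3 * Cmod xi ^ 3).
  { rewrite <- Rpow_mult_distr. apply pow_incr. split; [apply Cmod_ge_0|exact Hw]. }
  (* The part of w^2 of order at least three, moved to the error so that the second-order term stays
     a complex multiple of xi^2. *)
  pose (o := (2 * (q1 * q2) * (xi * (xi * xi)) + q2 * q2 * ((xi * xi) * (xi * xi)))%C).
  assert (Ew2 : (w * w)%C = (q1 * q1 * (xi * xi) + o)%C) by (unfold w, o; ring).
  assert (Ho : Cmod o <= (2 * (Cmod q1 * Cmod q2) + Cmod q2 * Cmod q2) * Cmod xi ^ 3).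
  { unfold o. apply Rle_trans with (1 := Cmod_triangle _ _). rewrite !Cmod_mult.
    replace (Cmod (RtoC 2)) with 2 by (rewrite Cmod_R, Rabs_pos_eq; lra).
    assert (Cmod q2 * Cmod q2 * (Cmod xi * Cmod xi * (Cmod xi * Cmod xi)) <=
      Cmod q2 * Cmod q2 * (Cmod xi ^ 3)).
    { apply Rmult_le_compat_l; [nra|].
      replace (Cmod xi * Cmod xi * (Cmod xi * Cmod xi)) with (Cmod xi ^ 3 * Cmod xi) by ring.
      rewrite <- (Rmult_1_r (Cmod xi ^ 3)) at 2. apply Rmult_le_compat_l; [apply pow_le|]; lra. }
    lra. }
  pose proof (fst_le_Cmod (- o)%C) as Hfo. rewrite Cmod_opp in Hfo.
  assert (Efo : 2 * fst w - fst (w * w)%C =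
    fst (2 * q1 * xi + (2 * q2 - q1 * q1) * (xi * xi))%C + fst (- o)%C).
  { rewrite Ew2. unfold w. cbn. ring. }
  lra.
Qed.

(** * Maximum principle along discs *)

Lemma cv_N2 x l : cv_C x l -> Un_cv (fun n => N2 (x n)) (N2 l).
Proof.
  intros H.
  assert (Hm : Un_cv (fun n => Cmod (x n)) (Cmod l)).
  { intros e He. destruct (H e He) as [N HN]. exists N. intros n Hn. unfold R_dist.
    apply Rle_lt_trans with (2 := HN n Hn). apply Rabs_le.
    pose proof (Cmod_sub_ge (x n) l). pose proof (Cmod_sub_ge l (x n)) as H1.
    rewrite (Cmod_minus_sym l) in H1. lra. }
  rewrite <- Cmod_sq. intros e He. destruct (CV_mult _ _ _ _ Hm Hm e He) as [N HN].
  exists N. intros n Hn. rewrite <- Cmod_sq. apply HN, Hn.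
Qed.

Lemma Un_cv_le_lim u l B : Un_cv u l -> (forall n, u n <= B) -> l <= B.
Proof.
  intros H HB. apply Rnot_lt_le. intros Hlt.
  destruct (H (l - B) ltac:(lra)) as [N HN]. specialize (HN N (le_n _)). unfold R_dist in HN.
  apply Rabs_lt_between in HN. specialize (HB N). lra.
Qed.

Lemma phi_cv V phi b p : continuous_on2 V phi -> V p -> (forall n, V (b n)) -> seq_cv2 b p ->
  Un_cv (fun n => phi (b n)) (phi p).
Proof.
  intros Hc Hp Hb H e He. destruct (Hc p Hp e He) as (d & Hd & Hcd).
  destruct (H d Hd) as [N HN]. exists N. intros n Hn. unfold R_dist. apply Hcd; [apply Hb|].
  rewrite dist2_sym. apply HN, Hn.
Qed.

Definition seq_cont (D : C -> Prop) (g : C -> R) : Prop :=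
  forall x l, (forall n, D (x n)) -> D l -> cv_C x l -> Un_cv (fun n => g (x n)) (g l).

Definition padd (p e : C2) : C2 := (fst p + fst e, snd p + snd e)%C.

Definition nrm (e : C2) : R := N2 (fst e) + N2 (snd e).

Definition lip_on (D : C -> Prop) (F : C -> C2) : Prop :=
  exists L, forall x y, D x -> D y -> dist2 (F x) (F y) <= L * Cmod (x - y)%C.

Lemma lip_cv D F x l : lip_on D F -> (forall n, D (x n)) -> D l -> cv_C x l ->
  seq_cv2 (fun n => F (x n)) (F l).
Proof.
  intros [L HL] Hx Hl H e He. pose proof (Rabs_pos L). pose proof (Rle_abs L).
  destruct (H (e / (Rabs L + 1))) as [N HN]; [apply Rdiv_lt_0_compat; lra|].
  exists N. intros n Hn. specialize (HN n Hn).
  apply Rle_lt_trans with (1 := HL _ _ (Hx n) Hl). pose proof (Cmod_ge_0 (x n - l)%C).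
  apply Rle_lt_trans with ((Rabs L + 1) * Cmod (x n - l)%C); [apply Rmult_le_compat_r; lra|].
  replace e with ((Rabs L + 1) * (e / (Rabs L + 1))) by (field; lra).
  apply Rmult_lt_compat_l; lra.
Qed.

Definition annulus (c : C) (r R0 : R) (z : C) : Prop := r <= Cmod (z - c)%C <= R0.

Lemma annulus_limit c r R0 x l : (forall n, annulus c r R0 (x n)) -> cv_C x l -> annulus c r R0 l.
Proof.
  intros H Hl. split; [apply (cv_C_ge x)|apply (cv_C_le x)]; auto; intros n; apply H.
Qed.

Lemma nrm_Cmod e rho : 0 <= rho -> nrm e <= rho * rho -> Cmod (fst e) <= rho /\ Cmod (snd e) <= rho.
Proof.
  intros Hr H. unfold nrm in H. pose proof (N2_ge0 (fst e)). pose proof (N2_ge0 (snd e)).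
  split; apply N2_le_Cmod; lra.
Qed.

Lemma padd_cv2 (b e : nat -> C2) p q : seq_cv2 b p ->
  cv_C (fun n => fst (e n)) (fst q) -> cv_C (fun n => snd (e n)) (snd q) ->
  seq_cv2 (fun n => padd (b n) (e n)) (padd p q).
Proof.
  assert (Hadd : forall x y l m, cv_C x l -> cv_C y m -> cv_C (fun n => x n + y n)%C (l + m)%C).
  { intros x y l m Hx Hy d Hd. destruct (Hx (d / 2) ltac:(lra)) as [N HN].
    destruct (Hy (d / 2) ltac:(lra)) as [N' HN']. exists (max N N'). intros n Hn.
    specialize (HN n ltac:(lia)). specialize (HN' n ltac:(lia)).
    replace (x n + y n - (l + m))%C with ((x n - l) + (y n - m))%C by ring.
    apply Rle_lt_trans with (1 := Cmod_triangle _ _). lra. }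
  intros Hb H1 H2. destruct (cv2_coord _ _ Hb) as [Hb1 Hb2].
  apply coord_cv2; unfold padd; cbn [fst snd]; apply Hadd; assumption.
Qed.

(** Compactness in the pair of base point and shift. The case rho = 0 gives the maximum over the
    annulus alone. *)
Lemma doubled_max V phi F c r R0 v rho K :
  continuous_on2 V phi -> lip_on (annulus c r R0) F -> seq_cont (annulus c r R0) v -> 0 <= rho ->
  (forall z e, annulus c r R0 z -> nrm e <= rho * rho -> V (padd (F z) e)) ->
  (exists z, annulus c r R0 z) ->
  exists z e, annulus c r R0 z /\ nrm e <= rho * rho /\
    forall z' e', annulus c r R0 z' -> nrm e' <= rho * rho ->
      phi (padd (F z') e') - v z' - K * nrm e' <= phi (padd (F z) e) - v z - K * nrm e.
Proof.
  intros Hc HF Hv Hrho HV [z0 Hz0].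
  destruct (attain_max (C * C2)
    (fun x => annulus c r R0 (fst x) /\ nrm (snd x) <= rho * rho)
    (fun x => phi (padd (F (fst x)) (snd x)) - v (fst x) - K * nrm (snd x))) as ([z e] & [Hz He] & Hmax).
  - exists (z0, (RtoC 0, RtoC 0)). split; [exact Hz0|]. unfold nrm, N2; cbn. nra.
  - intros x Hx.
    destruct (bounded_subseq (fun n j => match j with
      | O => fst (x n) | 1%nat => fst (snd (x n)) | _ => snd (snd (x n)) end)) as (s & l & Hs & Hl).
    { intros [|[|j]].
      - exists (R0 + Cmod c). intros n. destruct (Hx n) as [[_ H] _].
        pose proof (Cmod_sub_ge (fst (x n)) c). lra.
      - exists rho. intros n. apply (nrm_Cmod _ rho Hrho), Hx.
      - exists rho. intros n. apply (nrm_Cmod _ rho Hrho), Hx. }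
    pose proof (Hl O) as Hl0. pose proof (Hl 1%nat) as Hl1. pose proof (Hl 2%nat) as Hl2.
    cbn in Hl0, Hl1, Hl2.
    exists s, (l O, (l 1%nat, l 2%nat)). split; [exact Hs|]. cbn [fst snd].
    assert (Ha : annulus c r R0 (l O)) by (apply (annulus_limit _ _ _ _ _ (fun n => proj1 (Hx (s n))) Hl0)).
    assert (Hn : Un_cv (fun n => nrm (snd (x (s n)))) (nrm (l 1%nat, l 2%nat))).
    { unfold nrm; cbn [fst snd]. apply CV_plus; apply cv_N2; assumption. }
    assert (Hnl : nrm (l 1%nat, l 2%nat) <= rho * rho).
    { apply (Un_cv_le_lim _ _ _ Hn). intros n. apply Hx. }
    split; [split; assumption|].
    assert (Hcv : Un_cv (fun n => phi (padd (F (fst (x (s n)))) (snd (x (s n)))) - v (fst (x (s n)))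
       - K * nrm (snd (x (s n)))) (phi (padd (F (l O)) (l 1%nat, l 2%nat)) - v (l O) - K * nrm (l 1%nat, l 2%nat))).
    { apply CV_minus; [apply CV_minus|].
      - apply (phi_cv V phi); [exact Hc|apply HV; assumption|intros n; apply HV; apply Hx|].
        apply padd_cv2; [|exact Hl1|exact Hl2].
        apply (lip_cv (annulus c r R0) F); auto. intros n; apply Hx.
      - apply Hv; auto. intros n; apply Hx.
      - apply (CV_mult (fun _ => K)); [|exact Hn]. intros e He. exists O. intros n _.
        unfold R_dist. rewrite Rminus_diag, Rabs_R0. exact He. }
    intros e He. destruct (Hcv e He) as [N HN]. exists N. intros n Hn'.
    specialize (HN n Hn'). unfold R_dist in HN. apply Rabs_lt_between in HN. lra.
  - exists z, e. split; [exact Hz|]. split; [exact He|]. intros z' e' Hz' He'.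
    exact (Hmax (z', e') (conj Hz' He')).
Qed.

(** Counterexamples with shifts tending to 0 would accumulate at some [F z], where openness of [V]
    and continuity of [phi] exclude them. *)
Lemma uniform_tube V phi F c r R0 gam :
  open2 V -> continuous_on2 V phi -> lip_on (annulus c r R0) F ->
  (forall z, annulus c r R0 z -> V (F z)) -> 0 < gam ->
  exists rho, 0 < rho /\ forall z e, annulus c r R0 z -> nrm e <= rho * rho ->
    V (padd (F z) e) /\ phi (padd (F z) e) < phi (F z) + gam.
Proof.
  intros HV Hc HF HFV Hgam. apply NNPP. intros Hno.
  assert (H : forall n : nat, exists x : C * C2, annulus c r R0 (fst x) /\
    nrm (snd x) <= / (INR n + 1) * / (INR n + 1) /\
    ~ (V (padd (F (fst x)) (snd x)) /\ phi (padd (F (fst x)) (snd x)) < phi (F (fst x)) + gam)).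
  { intros n. apply NNPP. intros Hn. apply Hno. exists (/ (INR n + 1)).
    split; [apply inv_INR_pos|]. intros z e Hz He. apply NNPP. intros Hze. apply Hn.
    exists (z, e). cbn [fst snd]. auto. }
  pose (x := fun n => proj1_sig (constructive_indefinite_description _ (H n))).
  assert (Hx : forall n, annulus c r R0 (fst (x n)) /\
    nrm (snd (x n)) <= / (INR n + 1) * / (INR n + 1) /\
    ~ (V (padd (F (fst (x n))) (snd (x n))) /\
       phi (padd (F (fst (x n))) (snd (x n))) < phi (F (fst (x n))) + gam))
    by (intros n; exact (proj2_sig (constructive_indefinite_description _ (H n)))).
  destruct (bounded_subseq (fun n _ => fst (x n))) as (s & l & Hs & Hl).
  { intros _. exists (R0 + Cmod c). intros n. destruct (Hx n) as [[_ Hb] _].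
    pose proof (Cmod_sub_ge (fst (x n)) c). lra. }
  specialize (Hl O). set (z := l O) in *. cbn in Hl.
  assert (Hz : annulus c r R0 z) by (apply (annulus_limit _ _ _ _ _ (fun n => proj1 (Hx (s n))) Hl)).
  assert (Hsmall : forall d, 0 < d -> exists N, forall n, (N <= n)%nat -> / (INR (s n) + 1) < d).
  { intros d Hd. destruct (inv_INR_small d Hd) as [N HN]. exists N. intros n Hn. apply HN.
    pose proof (mono_ge s Hs n). lia. }
  pose proof (lip_cv _ F _ z HF (fun n => proj1 (Hx (s n))) Hz Hl) as HFcv.
  assert (He : cv_C (fun n => fst (snd (x (s n)))) (RtoC 0) /\
               cv_C (fun n => snd (snd (x (s n)))) (RtoC 0)).
  { split; intros d Hd; destruct (Hsmall d Hd) as [N HN]; exists N; intros n Hn;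
      (apply Rle_lt_trans with (2 := HN n Hn)).
    - replace (fst (snd (x (s n))) - RtoC 0)%C with (fst (snd (x (s n)))) by ring.
      apply (nrm_Cmod _ _ (Rlt_le _ _ (inv_INR_pos _))), Hx.
    - replace (snd (snd (x (s n))) - RtoC 0)%C with (snd (snd (x (s n)))) by ring.
      apply (nrm_Cmod _ _ (Rlt_le _ _ (inv_INR_pos _))), Hx. }
  pose proof (padd_cv2 _ (fun n => snd (x (s n))) _ (RtoC 0, RtoC 0) HFcv (proj1 He) (proj2 He)) as Hpcv.
  replace (padd (F z) (RtoC 0, RtoC 0)) with (F z) in Hpcv.
  2: { unfold padd. cbn [fst snd]. rewrite (surjective_pairing (F z)) at 1. f_equal; ring. }
  pose proof (HFV z Hz) as HVz.
  destruct (HV _ HVz) as (r1 & Hr1 & Hball).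
  destruct (Hc _ HVz (gam / 2) ltac:(lra)) as (d & Hd & Hcd).
  destruct (HFcv d Hd) as [N1 HN1].
  destruct (Hpcv (Rmin r1 d) (Rmin_pos _ _ Hr1 Hd)) as [N2' HN2].
  set (n := max N1 N2'). specialize (HN1 n ltac:(lia)). specialize (HN2 n ltac:(lia)).
  rewrite dist2_sym in HN1, HN2.
  destruct (Hx (s n)) as (Hzn & _ & Hbad). apply Hbad.
  assert (HVp : V (padd (F (fst (x (s n)))) (snd (x (s n))))).
  { apply Hball. apply Rlt_le_trans with (1 := HN2), Rmin_l. }
  split; [exact HVp|].
  pose proof (Hcd _ HVp (Rlt_le_trans _ _ _ HN2 (Rmin_r _ _))) as H1.
  pose proof (Hcd _ (HFV _ Hzn) HN1) as H2.
  apply Rabs_lt_between in H1, H2. lra.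
Qed.

Lemma cdot_le a b : Rabs (cdot a b) <= Cmod a * Cmod b.
Proof.
  replace (cdot a b) with (fst (a * Cconj b)%C) by (unfold cdot; cbn; ring).
  apply Rle_trans with (1 := Rabs_fst_Cmod _). rewrite Cmod_mult, Cmod_conj. lra.
Qed.

(* The first-order term is absent and the quadratic one is harmonic because the remainder of
   a holomorphic map after its linear part starts with [d xi^2]. *)
Lemma penalty_taylor (e d : C) C0 : exists be C1, 0 <= C1 /\ forall xi rem, Cmod xi <= 1 ->
  Cmod (rem - d * (xi * xi))%C <= C0 * Cmod xi ^ 3 ->
  N2 (e - rem)%C <= N2 e + fst (be * (xi * xi))%C + C1 * Cmod xi ^ 3.
Proof.
  exists (- (2 * (Cconj e * d)))%C, (2 * (Cmod e * Rabs C0) + (Cmod d + Rabs C0) ^ 2).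
  pose proof (Cmod_ge_0 e) as He. pose proof (Cmod_ge_0 d) as Hd. pose proof (Rabs_pos C0) as HC.
  split; [nra|]. intros xi rem Hxi Hrem. pose proof (Cmod_ge_0 xi) as Hx.
  set (o := (rem - d * (xi * xi))%C) in *.
  assert (H3 : 0 <= Cmod xi ^ 3) by (apply pow_le; lra).
  assert (Ho : Cmod o <= Rabs C0 * Cmod xi ^ 3).
  { apply Rle_trans with (1 := Hrem). apply Rmult_le_compat_r; [lra|apply Rle_abs]. }
  assert (Erem : rem = (d * (xi * xi) + o)%C) by (unfold o; ring).
  assert (Hm : Cmod rem <= (Cmod d + Rabs C0) * Cmod xi ^ 2).
  { rewrite Erem. apply Rle_trans with (1 := Cmod_triangle _ _). rewrite !Cmod_mult.
    assert (Cmod xi ^ 3 <= Cmod xi ^ 2).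
    { replace (Cmod xi ^ 3) with (Cmod xi ^ 2 * Cmod xi) by ring.
      rewrite <- (Rmult_1_r (Cmod xi ^ 2)) at 2. apply Rmult_le_compat_l; [apply pow_le|]; lra. }
    assert (Rabs C0 * Cmod xi ^ 3 <= Rabs C0 * Cmod xi ^ 2) by (apply Rmult_le_compat_l; lra).
    simpl in *. lra. }
  assert (Hn : N2 rem <= (Cmod d + Rabs C0) ^ 2 * Cmod xi ^ 3).
  { rewrite <- Cmod_sq. pose proof (Cmod_ge_0 rem).
    apply Rle_trans with (((Cmod d + Rabs C0) * Cmod xi ^ 2) * ((Cmod d + Rabs C0) * Cmod xi ^ 2)).
    - apply Rmult_le_compat; lra.
    - replace ((Cmod d + Rabs C0) * Cmod xi ^ 2 * ((Cmod d + Rabs C0) * Cmod xi ^ 2))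
        with ((Cmod d + Rabs C0) ^ 2 * (Cmod xi ^ 3 * Cmod xi)) by ring.
      apply Rmult_le_compat_l; [apply pow_le; lra|].
      rewrite <- (Rmult_1_r (Cmod xi ^ 3)) at 2. apply Rmult_le_compat_l; lra. }
  assert (E : N2 (e - rem)%C =
    N2 e + fst (- (2 * (Cconj e * d)) * (xi * xi))%C - 2 * cdot e o + N2 rem).
  { rewrite Erem. unfold N2, cdot. cbn. ring. }
  pose proof (cdot_le e o) as Hcd. apply Rabs_le_between in Hcd.
  assert (Cmod e * Cmod o <= Cmod e * (Rabs C0 * Cmod xi ^ 3)) by (apply Rmult_le_compat_l; lra).
  rewrite E. lra.
Qed.

(** Second-order expansion as for a holomorphic map, with tangent direction [b]: the quadratic term
    is a multiple of xi^2 without an |xi|^2 part. *)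
Definition taylor2 (F : C -> C2) (z : C) : Prop :=
  exists (b d : C2) C0 r0, 0 < r0 /\ forall xi, Cmod xi <= r0 ->
    Cmod (fst (F (z + xi)%C) - fst (F z) - xi * fst b - fst d * (xi * xi))%C <= C0 * Cmod xi ^ 3 /\
    Cmod (snd (F (z + xi)%C) - snd (F z) - xi * snd b - snd d * (xi * xi))%C <= C0 * Cmod xi ^ 3.

Lemma nrm_le0 e : nrm e <= 0 -> e = (RtoC 0, RtoC 0).
Proof.
  intros H. destruct (nrm_Cmod e 0 (Rle_refl 0)) as [H1 H2]; [lra|].
  rewrite (surjective_pairing e). f_equal; apply Cmod_eq_0;
    [pose proof (Cmod_ge_0 (fst e))|pose proof (Cmod_ge_0 (snd e))]; lra.
Qed.

Lemma padd_0 p : padd p (RtoC 0, RtoC 0) = p.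
Proof. unfold padd. cbn [fst snd]. rewrite (surjective_pairing p) at 3. f_equal; ring. Qed.

Lemma nrm_0 : nrm (RtoC 0, RtoC 0) = 0.
Proof. unfold nrm, N2; cbn; ring. Qed.

(* Doubling of variables: maximise [phi (F z + e) - v z - K |e|^2] over [z] in the annulus and
   small [e].  At the maximum, moving [z] by [xi] and [F z + e] along the tangent line of [F] at
   [z] changes the penalty only by a harmonic term and [O(|xi|^3)], so plurisubharmonicity of
   [phi] on that line contradicts the strict superharmonicity of [v]. *)
Lemma annulus_max_principle V phi F c r R0 v eta x gam :
  open2 V -> continuous_on2 V phi -> psh_on V phi -> lip_on (annulus c r R0) F ->
  (forall z, annulus c r R0 z -> V (F z)) ->
  (forall z, r < Cmod (z - c)%C < R0 -> taylor2 F z) ->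
  seq_cont (annulus c r R0) v -> 0 < eta ->
  (forall z, r < Cmod (z - c)%C < R0 -> subT (- eta) v z) ->
  annulus c r R0 x -> 0 < gam ->
  (forall z, Cmod (z - c)%C = r \/ Cmod (z - c)%C = R0 -> annulus c r R0 z ->
     phi (F z) - v z + gam <= phi (F x) - v x) ->
  False.
Proof.
  intros HV Hc Hpsh HF HFV HT Hv Heta Hsub Hx Hgam Hbd.
  destruct (uniform_tube V phi F c r R0 (gam / 2) HV Hc HF HFV ltac:(lra)) as (rho & Hrho & Htube).
  destruct (doubled_max V phi F c r R0 v 0 0 Hc HF Hv (Rle_refl 0)) as (zM & eM & HzM & HeM & HM).
  { intros z e Hz He. rewrite (nrm_le0 e) by lra. rewrite padd_0. apply HFV, Hz. }
  { exists x; exact Hx. }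
  rewrite (nrm_le0 eM) in HM by lra. rewrite padd_0, nrm_0 in HM. clear HeM eM.
  assert (HM' : forall z, annulus c r R0 z -> phi (F z) - v z <= phi (F zM) - v zM).
  { intros z Hz. specialize (HM z (RtoC 0, RtoC 0) Hz). rewrite padd_0, nrm_0 in HM.
    specialize (HM ltac:(lra)). lra. }
  (* Large enough that a shift of full length [rho] costs more than any possible gain over the value
     at [x], which forces |e| < rho. *)
  pose (K := (phi (F zM) - v zM - (phi (F x) - v x) + gam) / (rho * rho)).
  assert (Hrr : 0 < rho * rho) by nra.
  pose proof (HM' x Hx) as HMx.
  assert (HK0 : 0 < K) by (apply Rdiv_lt_0_compat; lra).
  assert (EK : K * (rho * rho) = phi (F zM) - v zM - (phi (F x) - v x) + gam) by (unfold K; field; lra).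
  destruct (doubled_max V phi F c r R0 v rho K Hc HF Hv (Rlt_le _ _ Hrho)) as (z & e & Hz & He & Hmax).
  { intros z e Hz He. apply (Htube z e Hz He). }
  { exists x; exact Hx. }
  assert (Hge : phi (F x) - v x <= phi (padd (F z) e) - v z - K * nrm e).
  { specialize (Hmax x (RtoC 0, RtoC 0) Hx). rewrite padd_0, nrm_0 in Hmax.
    specialize (Hmax ltac:(lra)). lra. }
  destruct (Htube z e Hz He) as [HVa Hlt].
  assert (Hn0 : 0 <= nrm e) by (unfold nrm; pose proof (N2_ge0 (fst e)); pose proof (N2_ge0 (snd e)); lra).
  (* On the boundary circles the deficit [gam] exceeds the gam/2 that a shift can gain. *)
  assert (Hzint : r < Cmod (z - c)%C < R0).
  { destruct Hz as [Hz1 Hz2].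
    split; apply Rnot_le_lt; intros Hle.
    - specialize (Hbd z (or_introl (Rle_antisym _ _ Hle Hz1)) (conj Hz1 Hz2)). nra.
    - specialize (Hbd z (or_intror (Rle_antisym _ _ Hz2 Hle)) (conj Hz1 Hz2)). nra. }
  assert (Heint : nrm e < rho * rho).
  { apply Rnot_le_lt. intros Hle. specialize (HM' z Hz).
    assert (K * (rho * rho) <= K * nrm e) by (apply Rmult_le_compat_l; lra). lra. }
  destruct (HT z Hzint) as (b & d & C0 & r1 & Hr1 & Htay).
  destruct (Hsub z Hzint) as (al & be & C1 & r2 & Hr2 & HC1 & Hs).
  destruct (penalty_taylor (fst e) (fst d) C0) as (be1 & D1 & HD1 & Hp1).
  destruct (penalty_taylor (snd e) (snd d) C0) as (be2 & D2 & HD2 & Hp2).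
  set (B := Cmod be1 + Cmod be2 + D1 + D2).
  assert (HB : 0 <= B) by (unfold B; pose proof (Cmod_ge_0 be1); pose proof (Cmod_ge_0 be2); lra).
  pose (r3 := Rmin (Rmin 1 (Rmin r1 r2)) (Rmin (Rmin (Cmod (z - c)%C - r) (R0 - Cmod (z - c)%C))
    ((rho * rho - nrm e) / (B + 1)))).
  assert (Hr3 : 0 < r3).
  { unfold r3. repeat apply Rmin_pos; try lra. apply Rdiv_lt_0_compat; lra. }
  apply (psh_no_strict V phi (padd (F z) e) b al (be + RtoC K * (be1 + be2))%C
    (C1 + K * (D1 + D2)) r3 eta HV Hc Hpsh HVa Hr3 Heta).
  intros xi Hxi. pose proof (Cmod_ge_0 xi) as Hx0.
  assert (Hb1 : Cmod xi <= 1 /\ Cmod xi <= r1 /\ Cmod xi <= r2 /\ Cmod xi <= Cmod (z - c)%C - r /\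
    Cmod xi <= R0 - Cmod (z - c)%C /\ Cmod xi <= (rho * rho - nrm e) / (B + 1)).
  { unfold r3 in Hxi.
    repeat split; apply Rle_trans with (1 := Hxi).
    - apply Rle_trans with (1 := Rmin_l _ _), Rmin_l.
    - apply Rle_trans with (1 := Rmin_l _ _). apply Rle_trans with (1 := Rmin_r _ _), Rmin_l.
    - apply Rle_trans with (1 := Rmin_l _ _). apply Rle_trans with (1 := Rmin_r _ _), Rmin_r.
    - apply Rle_trans with (1 := Rmin_r _ _). apply Rle_trans with (1 := Rmin_l _ _), Rmin_l.
    - apply Rle_trans with (1 := Rmin_r _ _). apply Rle_trans with (1 := Rmin_l _ _), Rmin_r.
    - apply Rle_trans with (1 := Rmin_r _ _), Rmin_r. }
  destruct Hb1 as (Hxi1 & Hxi2 & Hxi3 & Hxi4 & Hxi5 & Hxi6).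
  destruct (Htay xi Hxi2) as [Ht1 Ht2]. specialize (Hs xi Hxi3).
  set (rem1 := (fst (F (z + xi)%C) - fst (F z) - xi * fst b)%C) in *.
  set (rem2 := (snd (F (z + xi)%C) - snd (F z) - xi * snd b)%C) in *.
  specialize (Hp1 xi rem1 Hxi1 Ht1). specialize (Hp2 xi rem2 Hxi1 Ht2).
  pose (e' := (fst e - rem1, snd e - rem2)%C : C2).
  (* A point of the tangent line is read as a shift of F(z + xi), so it competes in the doubled
     maximum; the Taylor remainder goes into [e']. *)
  assert (Ea : c2_line (padd (F z) e) xi b = padd (F (z + xi)%C) e').
  { unfold c2_line, padd, e', rem1, rem2. cbn [fst snd]. f_equal; ring. }
  assert (Hz' : annulus c r R0 (z + xi)%C).
  { unfold annulus. replace (z + xi - c)%C with ((z - c) + xi)%C by ring.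
    pose proof (Cmod_triangle (z - c) xi)%C. pose proof (Cmod_sub_ge (z - c) (- xi))%C as H1.
    rewrite Cmod_opp in H1. replace (z - c - - xi)%C with (z - c + xi)%C in H1 by ring. lra. }
  assert (He' : nrm e' <= nrm e + fst ((be1 + be2) * (xi * xi))%C + (D1 + D2) * Cmod xi ^ 3).
  { unfold nrm, e'. cbn [fst snd].
    replace (fst ((be1 + be2) * (xi * xi))%C) with (fst (be1 * (xi * xi))%C + fst (be2 * (xi * xi))%C)
      by (cbn; ring). lra. }
  assert (Hsq : Cmod xi * Cmod xi <= Cmod xi) by nra.
  assert (Hcu : Cmod xi ^ 3 <= Cmod xi).
  { replace (Cmod xi ^ 3) with (Cmod xi * (Cmod xi * Cmod xi)) by ring. nra. }
  assert (He'2 : nrm e' <= rho * rho).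
  { apply Rle_trans with (1 := He').
    assert (H1 : fst ((be1 + be2) * (xi * xi))%C <= (Cmod be1 + Cmod be2) * Cmod xi).
    { apply Rle_trans with (1 := fst_le_Cmod _). rewrite !Cmod_mult.
      pose proof (Cmod_triangle be1 be2). pose proof (Cmod_ge_0 (be1 + be2)%C).
      apply Rmult_le_compat; nra. }
    assert (H2 : (D1 + D2) * Cmod xi ^ 3 <= (D1 + D2) * Cmod xi) by (apply Rmult_le_compat_l; lra).
    assert (H3 : Cmod xi * (B + 1) <= rho * rho - nrm e).
    { apply Rle_trans with ((rho * rho - nrm e) / (B + 1) * (B + 1)); [|right; field; lra].
      apply Rmult_le_compat_r; lra. }
    unfold B in H3. lra. }
  specialize (Hmax _ e' Hz' He'2). rewrite Ea.
  apply (Rmult_le_compat_l K) in He'; [|lra].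
  replace (fst (al * xi + (be + RtoC K * (be1 + be2)) * (xi * xi))%C)
    with (fst (al * xi + be * (xi * xi))%C + K * fst ((be1 + be2) * (xi * xi))%C) by (cbn; ring).
  lra.
Qed.

Lemma seq_cont_minus D f g : seq_cont D f -> seq_cont D g -> seq_cont D (fun z => f z - g z).
Proof. intros Hf Hg x l Hx Hl H. apply CV_minus; [apply Hf|apply Hg]; assumption. Qed.

Lemma seq_cont_plus D f g : seq_cont D f -> seq_cont D g -> seq_cont D (fun z => f z + g z).
Proof. intros Hf Hg x l Hx Hl H. apply CV_plus; [apply Hf|apply Hg]; assumption. Qed.

Lemma Un_cv_scal c u l : Un_cv u l -> Un_cv (fun n => c * u n) (c * l).
Proof.
  intros H. apply (CV_mult (fun _ => c)); [|exact H]. intros e He. exists O. intros n _.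
  unfold R_dist. rewrite Rminus_diag, Rabs_R0. exact He.
Qed.

Lemma seq_cont_scal D c f : seq_cont D f -> seq_cont D (fun z => c * f z).
Proof. intros Hf x l Hx Hl H. apply Un_cv_scal. apply Hf; assumption. Qed.

Lemma seq_cont_sub (D D' : C -> Prop) f : (forall z, D' z -> D z) -> seq_cont D f -> seq_cont D' f.
Proof. intros HD Hf x l Hx Hl H. apply Hf; auto. Qed.

Lemma cv_ln_N2 x l : cv_C x l -> l <> RtoC 0 -> Un_cv (fun n => ln (N2 (x n))) (ln (N2 l)).
Proof.
  intros H Hl. apply (continuity_seq ln (fun n => N2 (x n))).
  - apply derivable_continuous_pt. exists (/ N2 l). apply derivable_pt_lim_ln, N2_pos, Hl.
  - apply cv_N2, H.
Qed.

(* Three circles: if [phi o F - h] were below its maximum [m] at the centre, then a multiple of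
   [ln |z - c|] separates it from [m] on the punctured disc. *)
Lemma disc_strong_max V phi F c R0 h m x :
  open2 V -> continuous_on2 V phi -> psh_on V phi -> lip_on (annulus c 0 R0) F ->
  (forall z, annulus c 0 R0 z -> V (F z)) ->
  (forall z, Cmod (z - c)%C < R0 -> taylor2 F z) ->
  seq_cont (annulus c 0 R0) h ->
  (forall z, Cmod (z - c)%C < R0 -> subT 0 h z) ->
  (forall z, annulus c 0 R0 z -> phi (F z) - h z <= m) ->
  Cmod (x - c)%C < R0 -> phi (F x) - h x = m -> phi (F c) - h c = m.
Proof.
  intros HV Hc Hpsh HF HFV HT Hh Hsub Hm Hx Ex.
  destruct (Ceq_dec x c) as [->|Hxc]; [exact Ex|].
  assert (Hx0 : 0 < Cmod (x - c)%C).
  { apply Cmod_gt_0. intros E. apply Hxc. replace x with (x - c + c)%C by ring. rewrite E. ring. }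
  assert (Ecc : Cmod (c - c)%C = 0) by (replace (c - c)%C with (RtoC 0) by ring; apply Cmod_0).
  assert (Hcc : annulus c 0 R0 c) by (unfold annulus; rewrite Ecc; lra).
  apply Rle_antisym; [apply Hm, Hcc|]. apply Rnot_lt_le. intros Hlt.
  set (u := fun z => phi (F z) - h z).
  assert (Hu : seq_cont (annulus c 0 R0) u).
  { apply seq_cont_minus; [|exact Hh]. intros y l Hy Hl Hyl. apply (phi_cv V phi); auto.
    apply (lip_cv (annulus c 0 R0) F); auto. }
  set (c' := (m - u c) / 2). assert (Hc' : 0 < c') by (unfold c', u in *; lra).
  (* By continuity, half of the gap at the centre persists on a small disc, which becomes the inner
     hole of the annulus. *)
  assert (Hr : exists r, 0 < r < Cmod (x - c)%C /\
    forall z, annulus c 0 R0 z -> Cmod (z - c)%C <= r -> u z <= m - c').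
  { apply NNPP. intros Hno.
    assert (H : forall n : nat, exists z, annulus c 0 R0 z /\ Cmod (z - c)%C <= / (INR n + 1) /\ m - c' < u z).
    { intros n. apply NNPP. intros Hn. apply Hno.
      exists (Rmin (/ (INR n + 1)) (Cmod (x - c)%C / 2)). pose proof (inv_INR_pos n).
      split; [split; [apply Rmin_pos; lra|apply Rle_lt_trans with (1 := Rmin_r _ _); lra]|].
      intros z Hz Hzr. apply Rnot_lt_le. intros Hzu. apply Hn. exists z.
      split; [exact Hz|]. split; [|exact Hzu]. apply Rle_trans with (1 := Hzr), Rmin_l. }
    pose (y := fun n => proj1_sig (constructive_indefinite_description _ (H n))).
    assert (Hy : forall n, annulus c 0 R0 (y n) /\ Cmod (y n - c)%C <= / (INR n + 1) /\ m - c' < u (y n))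
      by (intros n; exact (proj2_sig (constructive_indefinite_description _ (H n)))).
    assert (Hyc : cv_C y c).
    { intros e He. destruct (inv_INR_small e He) as [N HN]. exists N. intros n Hn.
      apply Rle_lt_trans with (1 := proj1 (proj2 (Hy n))), HN, Hn. }
    destruct (Hu y c (fun n => proj1 (Hy n)) Hcc Hyc c' Hc') as [N HN].
    specialize (HN N (le_n _)). unfold R_dist in HN. apply Rabs_lt_between in HN.
    destruct (Hy N) as (_ & _ & H1). unfold c' in *. lra. }
  destruct Hr as (r & [Hr0 Hrx] & Hr).
  assert (Hsq : forall a b, 0 < a -> a < b -> a * a < b * b) by (intros; nra).
  set (Li := ln (r * r)). set (Lo := ln (R0 * R0)). set (Lx := ln (N2 (x - c)%C)).
  assert (HLi : Li < Lx).
  { unfold Lx. rewrite <- Cmod_sq. apply ln_increasing; [nra|]. apply Hsq; lra. }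
  assert (HLo : Lx < Lo).
  { unfold Lx. rewrite <- Cmod_sq. apply ln_increasing; [nra|]. apply Hsq; lra. }
  (* With this [kap] the gap c' on the inner circle compensates the smaller logarithm there. On both
     circles the comparison then falls short of [x] by kap (Lo - Lx) = 2 gam: one [gam] pays for the
     [eta] term, the other is the required deficit. *)
  pose (kap := c' / (Lo - Li)).
  assert (Hkap : 0 < kap) by (apply Rdiv_lt_0_compat; lra).
  assert (Ekap : kap * (Lo - Li) = c') by (unfold kap; field; lra).
  pose (gam := kap * (Lo - Lx) / 2). assert (Hgam : 0 < gam) by (unfold gam; nra).
  pose (eta := gam / (R0 * R0)). assert (HR : 0 < R0 * R0) by nra.
  assert (Heta : 0 < eta) by (apply Rdiv_lt_0_compat; lra).
  assert (Eeta : eta * (R0 * R0) = gam) by (unfold eta; field; lra).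
  assert (Hsubann : forall z, annulus c r R0 z -> annulus c 0 R0 z).
  { intros z [H1 H2]. split; [apply Cmod_ge_0|exact H2]. }
  assert (Hne : forall z, r <= Cmod (z - c)%C -> (z - c)%C <> RtoC 0).
  { intros z Hz E. rewrite E, Cmod_0 in Hz. lra. }
  apply (annulus_max_principle V phi F c r R0
    (fun z => h z + kap * ln (N2 (z - c)%C) + - eta * N2 (z - c)%C) eta x gam); auto.
  - destruct HF as [L HL]. exists L. intros y z Hy Hz. apply HL; auto.
  - intros z Hz. apply HT; lra.
  - apply seq_cont_plus; [apply seq_cont_plus|].
    + apply (seq_cont_sub (annulus c 0 R0)); auto.
    + apply seq_cont_scal. intros y l Hy Hl H. apply (cv_ln_N2 (fun n => y n - c)%C).
      * apply cv_C_minus_const, H.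
      * apply Hne, Hl.
    + apply seq_cont_scal. intros y l Hy Hl H. apply (cv_N2 (fun n => y n - c)%C).
      apply cv_C_minus_const, H.
  - intros z Hz. replace (subT (- eta)) with (subT (0 + kap * 0 + - eta)) by (f_equal; ring).
    apply (subT_plus (0 + kap * 0)); [apply (subT_plus 0)|].
    + apply Hsub; lra.
    + apply (subT_scal kap 0); [lra|].
      apply (subT_ln (fun y => (y - c)%C) z (RtoC 1) (RtoC 0)); [intros xi; ring|apply Hne; lra].
    + apply subT_N2.
  - split; lra.
  - intros z Hz Hann.
    assert (HN : N2 (z - c)%C <= R0 * R0).
    { rewrite <- Cmod_sq. destruct Hann. pose proof (Cmod_ge_0 (z - c)%C). nra. }
    assert (HNx : 0 <= eta * N2 (x - c)%C) by (apply Rmult_le_pos; [lra|apply N2_ge0]).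
    assert (HNz : eta * N2 (z - c)%C <= eta * (R0 * R0)) by (apply Rmult_le_compat_l; lra).
    fold Lx. rewrite Eeta in HNz.
    assert (E2 : 2 * gam = kap * (Lo - Lx)) by (unfold gam; field).
    destruct Hz as [Hz|Hz].
    + specialize (Hr z (Hsubann z Hann) ltac:(lra)). unfold u in Hr.
      replace (ln (N2 (z - c)%C)) with Li by (unfold Li; rewrite <- Cmod_sq, Hz; reflexivity).
      lra.
    + specialize (Hm z (Hsubann z Hann)).
      replace (ln (N2 (z - c)%C)) with Lo by (unfold Lo; rewrite <- Cmod_sq, Hz; reflexivity).
      lra.
Qed.

(** * Local uniformisation over the unit disc around a lattice point *)

(** The k-th root is itself the coordinate; the others are kept on the side of their values [o] over
    the centre, where they do not vanish. *)
Definition chart_roots (k : nat) (o : nat -> C) (zt : C) (j : nat) : C :=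
  if Nat.eq_dec j k then zt else rt (spiral k + zt * zt - spiral j)%C (o j).

Definition chart (k : nat) (o : nat -> C) (zt : C) : C2 :=
  (spiral k + zt * zt, CS (chart_roots k o zt))%C.

Lemma chart_roots_roots k o zt : roots (chart_roots k o zt) (spiral k + zt * zt)%C.
Proof.
  intros j Hj. unfold chart_roots. destruct (Nat.eq_dec j k) as [->|_]; [ring|apply rt_sq].
Qed.

(** The imaginary part of a conj b, as [cdot] is its real part; |cross| < cdot describes the open
    cone of half-angle pi/4 around [b]. *)
Definition cross (a b : C) : R := snd a * fst b - fst a * snd b.

(* The real and imaginary parts of [g conj o] satisfy
   [Re^2 - Im^2 = Re (g^2 conj o^2) = |o|^4 + Re (zt^2 conj o^2) > 0]. *)
Lemma root_cone g o zt : (g * g = o * o + zt * zt)%C -> 0 <= cdot g o -> N2 zt < N2 o ->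
  Rabs (cross g o) < cdot g o.
Proof.
  intros Hg Hd Hlt.
  assert (E : cdot g o * cdot g o - cross g o * cross g o =
    N2 o * N2 o + fst ((zt * zt) * (Cconj o * Cconj o))%C).
  { replace (cdot g o * cdot g o - cross g o * cross g o)
      with (fst ((g * g) * (Cconj o * Cconj o))%C) by (unfold cdot, cross; cbn; ring).
    rewrite Hg. unfold N2. cbn. ring. }
  pose proof (Rabs_fst_Cmod ((zt * zt) * (Cconj o * Cconj o))%C) as H.
  rewrite !Cmod_mult, !Cmod_conj, !Cmod_sq in H. apply Rabs_le_between in H.
  pose proof (N2_ge0 zt). assert (cross g o * cross g o < cdot g o * cdot g o) by nra.
  apply Rabs_def1; nra.
Qed.

Lemma cone_dot g g' o : 0 < N2 o -> Rabs (cross g o) < cdot g o -> Rabs (cross g' o) < cdot g' o ->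
  0 < cdot g g'.
Proof.
  intros Ho H H'. apply Rabs_def2 in H, H'.
  assert (E : cdot g g' * N2 o = cdot g o * cdot g' o + cross g o * cross g' o)
    by (unfold cdot, cross, N2; ring).
  assert (0 < cdot g g' * N2 o) by (rewrite E; nra).
  apply Rnot_le_lt. intros Hle. nra.
Qed.

Lemma center_root_N2 k o j : (1 <= k)%nat -> (1 <= j)%nat -> j <> k -> roots o (spiral k) -> 1 <= N2 (o j).
Proof.
  intros Hk Hj Hjk Ho. pose proof (spiral_sep k j Hk Hj (not_eq_sym Hjk)) as H.
  rewrite <- (Ho j Hj), N2_mult in H. pose proof (N2_ge0 (o j)). nra.
Qed.

Lemma over_root_cone k o j g zt : (1 <= k)%nat -> (1 <= j)%nat -> j <> k -> roots o (spiral k) ->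
  N2 zt < 1 -> (g * g = spiral k + zt * zt - spiral j)%C -> 0 <= cdot g (o j) ->
  Rabs (cross g (o j)) < cdot g (o j).
Proof.
  intros Hk Hj Hjk Ho Hzt Hg Hd. apply (root_cone g (o j) zt).
  - rewrite Hg, (Ho j Hj). ring.
  - exact Hd.
  - pose proof (center_root_N2 k o j Hk Hj Hjk Ho). lra.
Qed.

Lemma chart_roots_cone k o j zt : (1 <= k)%nat -> (1 <= j)%nat -> j <> k -> roots o (spiral k) ->
  N2 zt < 1 -> Rabs (cross (chart_roots k o zt j) (o j)) < cdot (chart_roots k o zt j) (o j).
Proof.
  intros Hk Hj Hjk Ho Hzt. apply (over_root_cone k o j _ zt); auto.
  - apply chart_roots_roots, Hj.
  - unfold chart_roots. destruct (Nat.eq_dec j k); [contradiction|]. apply rt_dot.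
Qed.

Lemma chart_roots_dot k o j zt zt' : (1 <= k)%nat -> (1 <= j)%nat -> j <> k -> roots o (spiral k) ->
  N2 zt < 1 -> N2 zt' < 1 -> 0 < cdot (chart_roots k o zt j) (chart_roots k o zt' j).
Proof.
  intros Hk Hj Hjk Ho H H'. apply (cone_dot _ _ (o j)).
  - pose proof (center_root_N2 k o j Hk Hj Hjk Ho). lra.
  - apply chart_roots_cone; assumption.
  - apply chart_roots_cone; assumption.
Qed.

Lemma cdot_opp_l a b : cdot (- a)%C b = - cdot a b.
Proof. unfold cdot; cbn; ring. Qed.

(** Both sequences are roots of the same numbers, and the cone around [o j] rules out the opposite
    sign. *)
Lemma chart_through k o s z : (1 <= k)%nat -> roots s z -> roots o (spiral k) -> linked s o ->
  N2 (s k) < 1 -> forall j, (1 <= j)%nat -> chart_roots k o (s k) j = s j.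
Proof.
  intros Hk Hs Ho HL Hn j Hj. destruct (Nat.eq_dec j k) as [->|Hjk].
  { unfold chart_roots. destruct (Nat.eq_dec k k); [reflexivity|contradiction]. }
  assert (Hsj : (s j * s j = spiral k + s k * s k - spiral j)%C)
    by (rewrite (Hs j Hj), (Hs k Hk); ring).
  destruct (sq_eq_pm (chart_roots k o (s k) j) (s j)) as [E|E]; [|exact E|exfalso].
  - rewrite Hsj. apply chart_roots_roots, Hj.
  - pose proof (chart_roots_cone k o j (s k) Hk Hj Hjk Ho Hn) as H1.
    pose proof (Rabs_pos (cross (chart_roots k o (s k) j) (o j))).
    rewrite E, cdot_opp_l in H1. specialize (HL j Hj). rewrite <- E in H1. lra.
Qed.

(** [s'] is compared with [s], which already lies on the chart, and not with [o]: being linked is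
    not transitive, but the chart roots at two points make a strictly acute angle. *)
Lemma chart_through_linked k o s s' z z' : (1 <= k)%nat -> roots s z -> roots s' z' ->
  roots o (spiral k) -> linked s o -> linked s s' -> N2 (s k) < 1 -> N2 (s' k) < 1 ->
  forall j, (1 <= j)%nat -> chart_roots k o (s' k) j = s' j.
Proof.
  intros Hk Hs Hs' Ho HL HL' Hn Hn' j Hj. destruct (Nat.eq_dec j k) as [->|Hjk].
  { unfold chart_roots. destruct (Nat.eq_dec k k); [reflexivity|contradiction]. }
  assert (Hsj : (s' j * s' j = spiral k + s' k * s' k - spiral j)%C)
    by (rewrite (Hs' j Hj), (Hs' k Hk); ring).
  destruct (sq_eq_pm (chart_roots k o (s' k) j) (s' j)) as [E|E]; [|exact E|exfalso].
  - rewrite Hsj. apply chart_roots_roots, Hj.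
  - pose proof (chart_roots_dot k o j (s' k) (s k) Hk Hj Hjk Ho Hn' Hn) as H1.
    rewrite (chart_through k o s z Hk Hs Ho HL Hn j Hj), E, cdot_opp_l, cdot_sym in H1.
    specialize (HL' j Hj). lra.
Qed.

Lemma CS_ext s t : (forall k, (1 <= k)%nat -> s k = t k) -> CS s = CS t.
Proof.
  intros H. unfold CS. f_equal; apply Series_ext; intros k; rewrite (H (S k)) by lia; reflexivity.
Qed.

(** Since |g| <= |g + g'|, a root bounded away from zero is Lipschitz in its square, better than the
    1/2-Hölder bound of [root_dist]. *)
Lemma root_increment g g' N : (g' * g' = g * g + N)%C -> 0 <= cdot g g' ->
  Cmod (g' - g)%C * Cmod g <= Cmod N.
Proof.
  intros H Hd. replace N with ((g' - g) * (g' + g))%C.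
  - rewrite Cmod_mult. apply Rmult_le_compat_l; [apply Cmod_ge_0|].
    apply N2_le_Cmod; [apply Cmod_ge_0|]. rewrite Cmod_sq. unfold N2, cdot in *; cbn in *. nra.
  - replace ((g' - g) * (g' + g))%C with (g' * g' - g * g)%C by ring. rewrite H. ring.
Qed.

(** Radius 19/20 keeps the chart away from the neighbouring branch points: 1 - (19/20)^2 exceeds
    (1/4)^2. *)
Lemma chart_roots_lower k o j zt : (1 <= k)%nat -> (1 <= j)%nat -> j <> k ->
  Cmod zt <= 19 / 20 -> 1 / 4 <= Cmod (chart_roots k o zt j).
Proof.
  intros Hk Hj Hjk Hzt. apply N2_ge_Cmod; [lra|]. rewrite <- Cmod_sq.
  rewrite <- Cmod_mult, (chart_roots_roots k o zt j Hj).
  pose proof (spiral_sep k j Hk Hj (not_eq_sym Hjk)) as H.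
  assert (H1 : 1 <= Cmod (spiral k - spiral j)%C) by (apply N2_ge_Cmod; lra).
  pose proof (Cmod_sub_ge (spiral k - spiral j) (- (zt * zt)))%C as H2.
  rewrite Cmod_opp, Cmod_mult in H2. pose proof (Cmod_ge_0 zt).
  replace (spiral k - spiral j - - (zt * zt))%C with (spiral k + zt * zt - spiral j)%C in H2 by ring.
  nra.
Qed.

Lemma N2_lt_1 zt : Cmod zt <= 19 / 20 -> N2 zt < 1.
Proof. intros H. rewrite <- Cmod_sq. pose proof (Cmod_ge_0 zt). nra. Qed.

Lemma pow2_ge1 k : 1 <= 2 ^ k.
Proof. apply pow_R1_Rle; lra. Qed.

Lemma tame_const B s : 0 <= B -> (forall k, (1 <= k)%nat -> Cmod (s k) <= B) -> tame B s.
Proof. intros HB H k Hk. specialize (H k Hk). pose proof (pow2_ge1 k). nra. Qed.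

Lemma chart_roots_tame k o zt : exists B, tame B (chart_roots k o zt).
Proof. eexists. apply (roots_tame _ _ _ (chart_roots_roots k o zt) (Rle_refl _)). Qed.

Lemma chart_lip k o : (1 <= k)%nat -> roots o (spiral k) ->
  lip_on (fun zt => Cmod zt <= 19 / 20) (chart k o).
Proof.
  intros Hk Ho. exists (2 + 2 * 8). intros x y Hx Hy.
  apply Rle_trans with (1 := dist2_le_sum _ _). unfold chart; cbn [fst snd].
  pose proof (Cmod_ge_0 (x - y)%C) as Hxy.
  assert (HN : forall a, (a + y * y - (a + x * x) = (y - x) * (y + x))%C) by (intros; ring).
  assert (Hsq : Cmod ((y - x) * (y + x))%C <= 2 * Cmod (x - y)%C).
  { rewrite Cmod_mult, (Cmod_minus_sym y x). pose proof (Cmod_triangle y x).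
    pose proof (Cmod_ge_0 (y + x)%C). nra. }
  assert (H1 : Cmod (spiral k + x * x - (spiral k + y * y))%C <= 2 * Cmod (x - y)%C).
  { rewrite Cmod_minus_sym, HN. exact Hsq. }
  assert (H2 : Cmod (CS (chart_roots k o x) - CS (chart_roots k o y))%C <= 2 * (8 * Cmod (x - y)%C)).
  { apply CS_diff; [apply chart_roots_tame|apply chart_roots_tame|].
    apply tame_const; [lra|]. intros j Hj. destruct (Nat.eq_dec j k) as [->|Hjk].
    - unfold chart_roots. destruct (Nat.eq_dec k k); [lra|contradiction].
    - pose proof (root_increment (chart_roots k o x j) (chart_roots k o y j) ((y - x) * (y + x))%C) as H.
      rewrite (Cmod_minus_sym (chart_roots k o x j)).
      pose proof (chart_roots_lower k o j x Hk Hj Hjk Hx).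
      pose proof (Cmod_ge_0 (chart_roots k o y j - chart_roots k o x j)%C).
      assert (Hi : Cmod (chart_roots k o y j - chart_roots k o x j)%C * Cmod (chart_roots k o x j)
        <= 2 * Cmod (x - y)%C).
      { apply Rle_trans with (2 := Hsq). apply H.
        - rewrite !(chart_roots_roots k o _ j Hj). ring.
        - apply Rlt_le, chart_roots_dot; auto using N2_lt_1. }
      nra. }
  lra.
Qed.

(* Solving [D^2 + 2 g D = N] for [D = g' - g] twice gives
   [D = N/(2g) - N^2/(8g^3) + N D^2/(4g^3) - D^4/(8g^3)]. *)
Lemma root_taylor g g' zt xi : (g' * g' = g * g + (2 * zt * xi + xi * xi))%C -> 0 <= cdot g g' ->
  1 / 4 <= Cmod g -> Cmod zt <= 1 -> Cmod xi <= 1 ->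
  Cmod (g' - g - xi * (zt / g) - (/ (2 * g) - zt * zt / (2 * (g * (g * g)))) * (xi * xi))%C
    <= 200000 * Cmod xi ^ 3.
Proof.
  intros Hg Hd Hlow Hzt Hxi.
  pose proof (Cmod_ge_0 xi) as Hx0. pose proof (Cmod_ge_0 zt) as Hz0.
  assert (Hg0 : g <> RtoC 0) by (intros E; rewrite E, Cmod_0 in Hlow; lra).
  set (N := (2 * zt * xi + xi * xi)%C) in *. set (D := (g' - g)%C) in *. set (i := (/ g)%C).
  assert (HN : Cmod N <= 3 * Cmod xi).
  { unfold N. apply Rle_trans with (1 := Cmod_triangle _ _). rewrite !Cmod_mult.
    replace (Cmod (RtoC 2)) with 2 by (rewrite Cmod_R, Rabs_pos_eq; lra). nra. }
  pose proof (Cmod_ge_0 N) as HN0. pose proof (Cmod_ge_0 D) as HD0.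
  assert (HD : Cmod D <= 12 * Cmod xi).
  { pose proof (root_increment g g' N Hg Hd) as H. fold D in H. nra. }
  assert (Hi : Cmod i <= 4).
  { unfold i. rewrite Cmod_inv by exact Hg0. replace 4 with (/ (1 / 4)) by lra.
    apply Rinv_le_contravar; lra. }
  pose proof (Cmod_ge_0 i) as Hi0.
  assert (ED : (N - (D * D + 2 * (g * D)) = 0)%C).
  { replace N with (g' * g' - g * g)%C by (rewrite Hg; ring). unfold D. ring. }
  assert (E : (D - xi * (zt / g) - (/ (2 * g) - zt * zt / (2 * (g * (g * g)))) * (xi * xi) =
    i * (i * i) * (N * (D * D) / 4 - (D * D) * (D * D) / 8 - xi * (xi * xi) * (4 * zt + xi) / 8))%C).
  { transitivity (i * (i * i) *
      (D * (g * (g * g)) - xi * zt * (g * g) - (g * g - zt * zt) / 2 * (xi * xi)))%C.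
    { unfold i. field. exact Hg0. }
    f_equal.
    (* The two sides agree modulo the relation [ED]; the added product is its multiple with the
       explicit cofactor. *)
    transitivity (N * (D * D) / 4 - (D * D) * (D * D) / 8 - xi * (xi * xi) * (4 * zt + xi) / 8 +
      (N - (D * D + 2 * (g * D))) * (N - (4 * (g * g) + D * D - 2 * (g * D))) / 8)%C.
    - unfold N. field.
    - rewrite ED. field. }
  rewrite E, !Cmod_mult.
  assert (Hi3 : Cmod i * (Cmod i * Cmod i) <= 64) by nra.
  assert (Hi30 : 0 <= Cmod i * (Cmod i * Cmod i)) by (repeat apply Rmult_le_pos; lra).
  assert (H8 : Cmod (RtoC 8) = 8) by (rewrite Cmod_R, Rabs_pos_eq; lra).
  assert (H4 : Cmod (RtoC 4) = 4) by (rewrite Cmod_R, Rabs_pos_eq; lra).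
  (* The three terms give 108 + 2592 + 5/8 < 3000, and 64 times 3000 is below 200000. *)
  assert (HX : Cmod (N * (D * D) / 4 - (D * D) * (D * D) / 8 - xi * (xi * xi) * (4 * zt + xi) / 8)%C
    <= 3000 * Cmod xi ^ 3).
  { set (n := Cmod xi) in *.
    assert (HDD : Cmod D * Cmod D <= 144 * (n * n)).
    { replace (144 * (n * n)) with ((12 * n) * (12 * n)) by ring. apply Rmult_le_compat; lra. }
    assert (HDD0 : 0 <= Cmod D * Cmod D) by nra.
    assert (Hn3 : 0 <= n ^ 3) by (apply pow_le; lra).
    assert (T1 : Cmod (N * (D * D) / 4)%C <= 108 * n ^ 3).
    { rewrite Cmod_div, H4, !Cmod_mult by (intros E0; injection E0; lra).
      assert (Cmod N * (Cmod D * Cmod D) <= (3 * n) * (144 * (n * n))) by (apply Rmult_le_compat; lra).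
      replace (108 * n ^ 3) with ((3 * n) * (144 * (n * n)) / 4) by field. lra. }
    assert (T2 : Cmod ((D * D) * (D * D) / 8)%C <= 2592 * n ^ 3).
    { rewrite Cmod_div, H8, !Cmod_mult by (intros E0; injection E0; lra).
      assert (Cmod D * Cmod D * (Cmod D * Cmod D) <= (144 * (n * n)) * (144 * (n * n)))
        by (apply Rmult_le_compat; lra).
      assert (n ^ 3 * n <= n ^ 3 * 1) by (apply Rmult_le_compat_l; lra).
      replace ((144 * (n * n)) * (144 * (n * n))) with (20736 * (n ^ 3 * n)) in H by ring. lra. }
    assert (T3 : Cmod (xi * (xi * xi) * (4 * zt + xi) / 8)%C <= 5 / 8 * n ^ 3).
    { rewrite Cmod_div, H8, !Cmod_mult by (intros E0; injection E0; lra). fold n.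
      assert (Cmod (4 * zt + xi)%C <= 5).
      { apply Rle_trans with (1 := Cmod_triangle _ _). rewrite Cmod_mult, H4. fold n. lra. }
      assert (n * (n * n) * Cmod (4 * zt + xi)%C <= n * (n * n) * 5).
      { apply Rmult_le_compat_l; [|assumption]. replace (n * (n * n)) with (n ^ 3) by ring. lra. }
      replace (n ^ 3) with (n * (n * n)) by ring. lra. }
    apply Rle_trans with (1 := Cmod_triangle _ _). rewrite Cmod_opp.
    pose proof (Cmod_triangle (N * (D * D) / 4) (- ((D * D) * (D * D) / 8)))%C as T4.
    rewrite Cmod_opp in T4. unfold Cminus in *. lra. }
  pose proof (Cmod_ge_0 (N * (D * D) / 4 - (D * D) * (D * D) / 8 - xi * (xi * xi) * (4 * zt + xi) / 8)%C).
  replace (200000 * Cmod xi ^ 3) with (64 * (3125 * Cmod xi ^ 3)) by ring.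
  pose proof (pow_le _ 3 Hx0). apply Rmult_le_compat; lra.
Qed.

(** The expansions of the single roots have coefficients and errors bounded uniformly in [j], so
    they can be summed; at index [k] the expansion is exact. *)
Lemma chart_taylor k o zt : (1 <= k)%nat -> roots o (spiral k) -> Cmod zt < 19 / 20 ->
  taylor2 (chart k o) zt.
Proof.
  intros Hk Ho Hzt.
  set (g := chart_roots k o zt).
  pose (al := fun j => if Nat.eq_dec j k then RtoC 1 else (zt / g j)%C).
  pose (be := fun j => if Nat.eq_dec j k then RtoC 0
                       else (/ (2 * g j) - zt * zt / (2 * (g j * (g j * g j))))%C).
  assert (Hlow : forall j, (1 <= j)%nat -> j <> k -> g j <> RtoC 0 /\ Cmod (/ g j)%C <= 4).
  { intros j Hj Hjk. pose proof (chart_roots_lower k o j zt Hk Hj Hjk ltac:(lra)) as Hl. fold g in Hl.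
    assert (Hg0 : g j <> RtoC 0) by (intros E; rewrite E, Cmod_0 in Hl; lra).
    split; [exact Hg0|]. rewrite Cmod_inv by exact Hg0. replace 4 with (/ (1 / 4)) by lra.
    apply Rinv_le_contravar; lra. }
  pose proof (Cmod_ge_0 zt) as Hz0.
  assert (Hal : tame 4 al).
  { apply tame_const; [lra|]. intros j Hj. unfold al. destruct (Nat.eq_dec j k) as [_|Hjk].
    - rewrite Cmod_1; lra.
    - destruct (Hlow j Hj Hjk) as [_ H]. unfold Cdiv. rewrite Cmod_mult.
      pose proof (Cmod_ge_0 (/ g j)%C). nra. }
  assert (Hbe : tame 100 be).
  { apply tame_const; [lra|]. intros j Hj. unfold be. destruct (Nat.eq_dec j k) as [_|Hjk].
    - rewrite Cmod_0; lra.
    - destruct (Hlow j Hj Hjk) as [Hg0 H]. pose proof (Cmod_ge_0 (/ g j)%C) as Hi0.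
      replace (/ (2 * g j) - zt * zt / (2 * (g j * (g j * g j))))%C
        with (/ 2 * (/ g j) * (1 - zt * zt * (/ g j * / g j)))%C by (field; exact Hg0).
      rewrite !Cmod_mult.
      assert (Cmod (/ RtoC 2)%C = / 2).
      { rewrite Cmod_inv, Cmod_R, Rabs_pos_eq; try lra. intros E; injection E; lra. }
      assert (Cmod (1 - zt * zt * (/ g j * / g j))%C <= 17).
      { apply Rle_trans with (1 := Cmod_triangle _ _). rewrite Cmod_opp, Cmod_1, !Cmod_mult.
        assert (Cmod zt * Cmod zt <= 1) by nra.
        assert (Cmod (/ g j)%C * Cmod (/ g j)%C <= 16) by nra.
        assert (0 <= Cmod zt * Cmod zt) by nra. assert (0 <= Cmod (/ g j)%C * Cmod (/ g j)%C) by nra.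
        nra. }
      rewrite H0. pose proof (Cmod_ge_0 (1 - zt * zt * (/ g j * / g j))%C). nra. }
  exists (2 * zt, CS al)%C, (RtoC 1, CS be), 400000, (Rmin 1 (19 / 20 - Cmod zt)).
  split; [apply Rmin_pos; lra|]. intros xi Hxi.
  assert (Hxi1 : Cmod xi <= 1) by (apply Rle_trans with (1 := Hxi), Rmin_l).
  assert (Hxi2 : Cmod xi <= 19 / 20 - Cmod zt) by (apply Rle_trans with (1 := Hxi), Rmin_r).
  pose proof (pow_le _ 3 (Cmod_ge_0 xi)) as H3.
  unfold chart; cbn [fst snd]. split.
  - replace (spiral k + (zt + xi) * (zt + xi) - (spiral k + zt * zt) - xi * (2 * zt) - 1 * (xi * xi))%C
      with (RtoC 0) by ring. rewrite Cmod_0. lra.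
  - fold g. set (g' := chart_roots k o (zt + xi)%C).
    assert (Hzx : Cmod (zt + xi)%C <= 19 / 20) by (pose proof (Cmod_triangle zt xi); lra).
    destruct (chart_roots_tame k o zt) as [B HB]. destruct (chart_roots_tame k o (zt + xi)%C) as [B' HB'].
    fold g in HB. fold g' in HB'.
    pose proof (tame_lin _ _ _ _ (- RtoC 1)%C HB' HB) as T1.
    pose proof (tame_lin _ _ _ _ (- xi)%C T1 Hal) as T2.
    replace (CS g' - CS g - xi * CS al - CS be * (xi * xi))%C
      with (CS (fun j => g' j + - RtoC 1 * g j + - xi * al j + - (xi * xi) * be j)%C).
    2: { rewrite (CS_lin _ _ _ _ _ T2 Hbe), (CS_lin _ _ _ _ _ T1 Hal), (CS_lin _ _ _ _ _ HB' HB). ring. }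
    replace (400000 * Cmod xi ^ 3) with (2 * (200000 * Cmod xi ^ 3)) by ring.
    apply CS_bound, tame_const; [lra|]. intros j Hj.
    destruct (Nat.eq_dec j k) as [->|Hjk].
    + unfold al, be, g, g', chart_roots. destruct (Nat.eq_dec k k); [|contradiction].
      replace (zt + xi + - RtoC 1 * zt + - xi * RtoC 1 + - (xi * xi) * RtoC 0)%C with (RtoC 0) by ring.
      rewrite Cmod_0. lra.
    + replace (g' j + - RtoC 1 * g j + - xi * al j + - (xi * xi) * be j)%C
        with (g' j - g j - xi * (zt / g j) -
          (/ (2 * g j) - zt * zt / (2 * (g j * (g j * g j)))) * (xi * xi))%C.
      2: { unfold al, be. destruct (Nat.eq_dec j k); [contradiction|]. ring. }
      apply root_taylor; try lra.
      * unfold g, g'. rewrite !(chart_roots_roots k o _ j Hj). ring.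
      * apply Rlt_le. apply chart_roots_dot; auto; apply N2_lt_1; lra.
      * apply chart_roots_lower; auto; lra.
Qed.

(** * Propagation of maxima and the Liouville property *)

(** The alternative on [del] lets one statement serve both the comparison with a logarithm away from
    0 and [phi] itself over the whole plane. *)
Lemma max_propagates_locally V phi del m z s z' s' :
  open2 V -> (forall p, wermer_set weps p -> V p) -> continuous_on2 V phi -> psh_on V phi -> 0 <= del ->
  (forall w, Cmod (w - z)%C < 2 -> del = 0 \/ w <> RtoC 0) ->
  (forall w t, roots t w -> Cmod (w - z)%C < 2 -> phi (w, CS t) - del * ln (N2 w) <= m) ->
  roots s z -> roots s' z' -> linked s s' -> Cmod (z - z')%C <= 1 / 1000 ->
  phi (z, CS s) - del * ln (N2 z) = m -> phi (z', CS s') - del * ln (N2 z') = m.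
Proof.
  intros HV HEV Hc Hpsh Hdel Hnz Hle Hs Hs' HL Hzz Hm.
  destruct (spiral_cover z) as (k & Hk & Hkz).
  destruct (linked_exists s (spiral k)) as (o & Ho & HLo).
  set (x := s k). set (c := s' k).
  assert (Hxx : (x * x = z - spiral k)%C) by (apply Hs, Hk).
  assert (Hcc : (c * c = z' - spiral k)%C) by (apply Hs', Hk).
  (* 0.7072 exceeds 1/sqrt 2. The step 1/1000 gives |c| <= 0.85 and |x - c| < 1/10, so the disc of
     radius 1/10 around [c] contains [x] and stays within the chart radius 0.95. *)
  assert (Hz1 : Cmod (z - spiral k)%C <= 7072 / 10000) by (apply N2_le_Cmod; lra).
  assert (Hz2 : Cmod (z' - spiral k)%C <= 7082 / 10000).
  { pose proof (Cmod_triangle3 z' z (spiral k)) as H. rewrite (Cmod_minus_sym z' z) in H. lra. }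
  assert (Hx2 : Cmod x * Cmod x <= 7072 / 10000) by (rewrite <- Cmod_mult, Hxx; exact Hz1).
  assert (Hc2 : Cmod c * Cmod c <= 7082 / 10000) by (rewrite <- Cmod_mult, Hcc; exact Hz2).
  pose proof (Cmod_ge_0 x) as Hx0. pose proof (Cmod_ge_0 c) as Hc0.
  assert (Hcb : Cmod c <= 17 / 20) by nra.
  assert (Hxc : Cmod (x - c)%C < 1 / 10).
  { pose proof (root_dist _ _ (HL k Hk)) as H. fold x c in H. rewrite Hxx, Hcc in H.
    replace (z - spiral k - (z' - spiral k))%C with (z - z')%C in H by ring.
    pose proof (Cmod_ge_0 (x - c)%C). nra. }
  assert (Hdisc : forall y, Cmod (y - c)%C <= 1 / 10 -> Cmod y <= 19 / 20).
  { intros y Hy. pose proof (Cmod_sub_ge y c). lra. }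
  assert (Hdisc' : forall y, Cmod (y - c)%C < 1 / 10 -> Cmod y < 19 / 20).
  { intros y Hy. pose proof (Cmod_sub_ge y c). lra. }
  assert (Hnear : forall y, Cmod y <= 19 / 20 -> Cmod (spiral k + y * y - z)%C < 2).
  { intros y Hy. replace (spiral k + y * y - z)%C with (y * y - (z - spiral k))%C by ring.
    apply Rle_lt_trans with (1 := Cmod_triangle _ _). rewrite Cmod_opp, Cmod_mult.
    pose proof (Cmod_ge_0 y). nra. }
  assert (Hn1 : N2 x < 1) by (rewrite <- Cmod_sq; lra).
  assert (Hn2 : N2 c < 1) by (rewrite <- Cmod_sq; lra).
  assert (Ex : chart k o x = (z, CS s)).
  { unfold chart. f_equal; [rewrite Hxx; ring|]. apply CS_ext.
    apply (chart_through k o s z); assumption. }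
  assert (Ec : chart k o c = (z', CS s')).
  { unfold chart. f_equal; [rewrite Hcc; ring|]. apply CS_ext.
    apply (chart_through_linked k o s s' z z'); assumption. }
  pose (P := fun y => (spiral k + y * y)%C).
  assert (Pz : forall y, Cmod y <= 19 / 20 -> del = 0 \/ P y <> RtoC 0).
  { intros y Hy. apply Hnz, Hnear, Hy. }
  rewrite <- Ec. replace z' with (P c) by (unfold P; rewrite Hcc; ring).
  (* The disc is centred at the target, because the strong maximum principle carries a maximum from
     an inner point to the centre. *)
  apply (disc_strong_max V phi (chart k o) c (1 / 10) (fun y => del * ln (N2 (P y))) m x); auto.
  - destruct (chart_lip k o Hk Ho) as [L HLip]. exists L. intros a b [_ Ha] [_ Hb].
    apply HLip; apply Hdisc; assumption.
  - intros y _. apply HEV, wermer_roots, chart_roots_roots.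
  - intros y Hy. apply chart_taylor; auto.
  - intros y l Hy [_ Hl] Hcv. destruct (Pz l (Hdisc _ Hl)) as [E|Hne].
    + rewrite E, Rmult_0_l. intros e He. exists O. intros n _. unfold R_dist.
      rewrite Rmult_0_l, Rminus_diag, Rabs_R0. exact He.
    + apply Un_cv_scal, (cv_ln_N2 (fun n => P (y n))); [|exact Hne].
      unfold P. intros e He. destruct (cv_C_mult _ _ _ _ Hcv Hcv e He) as [N HN].
      exists N. intros n Hn. specialize (HN n Hn).
      replace (spiral k + y n * y n - (spiral k + l * l))%C with (y n * y n - l * l)%C by ring.
      exact HN.
  - intros y Hy. destruct (Pz y ltac:(apply Rlt_le, Hdisc', Hy)) as [E|Hne].
    + exists (RtoC 0), (RtoC 0), 0, 1. split; [lra|]. split; [lra|]. intros xi _.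
      rewrite E. right. cbn. ring.
    + replace 0 with (del * 0) by ring. apply subT_scal; [exact Hdel|].
      apply (subT_ln P y (2 * y)%C (RtoC 1)); [intros xi; unfold P; ring|exact Hne].
  - intros y [_ Hy]. unfold chart. apply Hle; [apply chart_roots_roots|apply Hnear, Hdisc, Hy].
  - rewrite Ex. replace (P x) with z by (unfold P; rewrite Hxx; ring). exact Hm.
Qed.

Lemma max_propagates V phi del m (Reg : C -> Prop) :
  open2 V -> (forall p, wermer_set weps p -> V p) -> continuous_on2 V phi -> psh_on V phi -> 0 <= del ->
  (forall z z', Reg z -> Reg z' -> Reg ((z + z') / 2)%C) ->
  (forall z w, Reg z -> Cmod (w - z)%C < 2 -> del = 0 \/ w <> RtoC 0) ->
  (forall z w t, Reg z -> roots t w -> Cmod (w - z)%C < 2 -> phi (w, CS t) - del * ln (N2 w) <= m) ->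
  forall z s z' s', Reg z -> Reg z' -> roots s z -> roots s' z' -> linked s s' ->
  phi (z, CS s) - del * ln (N2 z) = m -> phi (z', CS s') - del * ln (N2 z') = m.
Proof.
  intros HV HEV Hc Hpsh Hdel Hmid Hnz Hle.
  apply (linked_halving Reg (fun z s => phi (z, CS s) - del * ln (N2 z) = m) (1 / 1000));
    [lra|exact Hmid|].
  intros z s z' s' Hz Hz' Hs Hs' HL Hd.
  apply (max_propagates_locally V phi del m z s z' s'); auto.
  - intros w Hw. apply (Hnz z); auto.
  - intros w t Ht Hw. apply (Hle z); auto.
Qed.

Lemma wermer_bounded_subseq (b : nat -> C2) R0 : (forall n, wermer_set weps (b n)) ->
  (forall n, Cmod (fst (b n)) <= R0) ->
  exists s p, mono s /\ wermer_set weps p /\ seq_cv2 (fun n => b (s n)) p.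
Proof.
  intros Hb HR.
  pose (s := fun n => proj1_sig (constructive_indefinite_description _ (wermer_set_roots _ (Hb n)))).
  assert (Hs : forall n, roots (s n) (fst (b n)) /\ b n = (fst (b n), CS (s n)))
    by (intros n; exact (proj2_sig (constructive_indefinite_description _ (wermer_set_roots _ (Hb n))))).
  destruct (roots_bounded_subseq (fun n => fst (b n)) s R0 (fun n => proj1 (Hs n)) HR)
    as (sg & zl & sl & Hsg & Hr & Hz & Hw).
  exists sg, (zl, CS sl). split; [exact Hsg|]. split; [apply wermer_roots, Hr|].
  apply coord_cv2; cbn [fst snd]; [exact Hz|].
  intros e He. destruct (Hw e He) as [N HN]. exists N. intros n Hn.
  rewrite (proj2 (Hs (sg n))). cbn [snd]. apply HN, Hn.
Qed.

(* Liouville: if [phi] exceeded its maximum over [|z| <= 3] somewhere, then for small [del > 0]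
   so would the maximum of [phi - del ln |z|^2] over [|z| >= 3]; that maximum propagates along a
   ray down to [|z| = 3]. *)
Lemma wermer_max_attained V phi M :
  open2 V -> (forall p, wermer_set weps p -> V p) -> continuous_on2 V phi -> psh_on V phi ->
  (forall p, V p -> phi p <= M) ->
  exists p, wermer_set weps p /\ forall q, wermer_set weps q -> phi q <= phi p.
Proof.
  intros HV HEV Hc Hpsh HM.
  destruct (attain_max C2 (fun p => wermer_set weps p /\ Cmod (fst p) <= 3) phi) as (p3 & [Hp3 _] & Hmax3).
  { destruct (roots_exist (RtoC 0)) as [s Hs]. exists (RtoC 0, CS s).
    split; [apply wermer_roots, Hs|]. cbn [fst]. rewrite Cmod_0. lra. }
  { intros b Hb.
    destruct (wermer_bounded_subseq b 3 (fun n => proj1 (Hb n)) (fun n => proj2 (Hb n)))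
      as (s & p & Hs & Hp & Hcv).
    exists s, p. split; [exact Hs|]. split; [split; [exact Hp|]|].
    - replace (fst p) with (fst p - RtoC 0)%C by ring.
      apply (cv_C_le _ _ _ _ (proj1 (cv2_coord _ _ Hcv))). intros n.
      replace (fst (b (s n)) - RtoC 0)%C with (fst (b (s n))) by ring. apply Hb.
    - intros e He.
      destruct (phi_cv V phi _ p Hc (HEV _ Hp) (fun n => HEV _ (proj1 (Hb (s n)))) Hcv e He) as [N HN].
      exists N. intros n Hn. specialize (HN n Hn). unfold R_dist in HN.
      apply Rabs_lt_between in HN. lra. }
  exists p3. split; [exact Hp3|]. intros q0 Hq0. apply Rnot_lt_le. intros Hlt.
  assert (Hq3 : 3 < Cmod (fst q0)).
  { apply Rnot_le_lt. intros Hle. specialize (Hmax3 q0 (conj Hq0 Hle)). lra. }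
  assert (Hln : forall z, 1 <= Cmod z -> 0 <= ln (N2 z)).
  { intros z Hz. rewrite <- ln_1. apply ln_le; [lra|]. rewrite <- Cmod_sq. nra. }
  assert (Hnz : forall z, 1 <= Cmod z -> z <> RtoC 0).
  { intros z Hz E. rewrite E, Cmod_0 in Hz. lra. }
  set (l0 := ln (N2 (fst q0))).
  assert (Hl0 : 0 < l0).
  { unfold l0. rewrite <- ln_1. apply ln_increasing; [lra|]. rewrite <- Cmod_sq. nra. }
  (* The logarithm uses up half of the gap between [q0] and [p3]. *)
  pose (del := (phi q0 - phi p3) / (2 * l0)).
  assert (Hdel : 0 < del) by (apply Rdiv_lt_0_compat; lra).
  pose (Phi := fun p : C2 => phi p - del * ln (N2 (fst p))).
  assert (HPhi0 : phi p3 < Phi q0).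
  { unfold Phi. fold l0. replace (del * l0) with ((phi q0 - phi p3) / 2) by (unfold del; field; lra). lra. }
  destruct (attain_max C2
    (fun p => wermer_set weps p /\ 3 <= Cmod (fst p) /\ Phi q0 <= Phi p) Phi)
    as (p & (Hp & Hp' & HpPhi) & Hmax).
  { exists q0. split; [exact Hq0|]. split; lra. }
  { intros b Hb.
    (* Where Phi >= Phi q0, the bound [M] gives del ln |z|^2 <= M - Phi q0; this confines z, so the
       maximum is sought on a compact set. *)
    destruct (wermer_bounded_subseq b (1 + exp ((M - Phi q0) / del)) (fun n => proj1 (Hb n)))
      as (s & p & Hs & Hp & Hcv).
    { intros n. destruct (Hb n) as (H1 & H2 & H3). pose proof (HM _ (HEV _ H1)) as H4.
      assert (H5 : ln (N2 (fst (b n))) <= (M - Phi q0) / del).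
      { apply Rmult_le_reg_l with del; [exact Hdel|].
        replace (del * ((M - Phi q0) / del)) with (M - Phi q0) by (field; lra).
        unfold Phi in H3 at 2. lra. }
      assert (H6 : N2 (fst (b n)) <= exp ((M - Phi q0) / del)).
      { rewrite <- (exp_ln (N2 (fst (b n)))) by (apply N2_pos, Hnz; lra).
        destruct H5 as [H5|H5]; [left; apply exp_increasing, H5|right; rewrite H5; reflexivity]. }
      rewrite <- Cmod_sq in H6. nra. }
    assert (Hcz : cv_C (fun n => fst (b (s n))) (fst p)) by apply (cv2_coord _ _ Hcv).
    assert (H3 : 3 <= Cmod (fst p)).
    { replace (fst p) with (fst p - RtoC 0)%C by ring. apply (cv_C_ge _ _ _ _ Hcz). intros n.
      replace (fst (b (s n)) - RtoC 0)%C with (fst (b (s n))) by ring. apply Hb. }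
    assert (HPcv : Un_cv (fun n => Phi (b (s n))) (Phi p)).
    { unfold Phi. apply CV_minus.
      - apply (phi_cv V phi); auto. intros n. apply HEV, Hb.
      - apply Un_cv_scal, (cv_ln_N2 (fun n => fst (b (s n)))); [exact Hcz|]. apply Hnz; lra. }
    exists s, p. split; [exact Hs|]. split; [split; [exact Hp|split; [exact H3|]]|].
    - apply Ropp_le_cancel. apply (Un_cv_le_lim (fun n => - Phi (b (s n)))).
      + apply (CV_opp (fun n => Phi (b (s n)))), HPcv.
      + intros n. apply Ropp_le_contravar, Hb.
    - intros e He. destruct (HPcv e He) as [N HN]. exists N. intros n Hn. specialize (HN n Hn).
      unfold R_dist in HN. apply Rabs_lt_between in HN. lra. }
  destruct (wermer_set_roots p Hp) as (s & Hs & Ep).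
  set (z := fst p) in *. set (u := (z * / RtoC (Cmod z))%C).
  assert (HCz : RtoC (Cmod z) <> RtoC 0) by (intros E; injection E; lra).
  assert (Hu : forall t, 0 <= t -> Cmod (RtoC t * u)%C = t).
  { intros t Ht. unfold u. rewrite !Cmod_mult, Cmod_inv, !Cmod_R by exact HCz.
    rewrite (Rabs_pos_eq t), (Rabs_pos_eq (Cmod z)) by lra. field. lra. }
  destruct (linked_exists s (RtoC 3 * u)%C) as (t & Ht & HL).
  assert (Hfin : phi (RtoC 3 * u, CS t)%C - del * ln (N2 (RtoC 3 * u)%C) = Phi p).
  (* The ray stays in |z| >= 3, so all points within distance 2 of it satisfy |w| >= 1, where the
     logarithm is nonnegative. *)
  { apply (max_propagates V phi del (Phi p) (fun w => exists a, 3 <= a /\ w = (RtoC a * u)%C))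
      with (z := z) (s := s); auto.
    - lra.
    - intros z1 z2 (a1 & H1 & ->) (a2 & H2 & ->). exists ((a1 + a2) / 2). split; [lra|].
      rewrite RtoC_div, RtoC_plus by lra. field.
    - intros z1 w (a & Ha & ->) Hw. right. apply Hnz.
      pose proof (Cmod_sub_ge (RtoC a * u)%C w) as H. rewrite Cmod_minus_sym, (Hu a) in H; lra.
    - intros z1 w t' (a & Ha & ->) Ht' Hw.
      assert (H1 : 1 <= Cmod w).
      { pose proof (Cmod_sub_ge (RtoC a * u)%C w) as H. rewrite Cmod_minus_sym, (Hu a) in H; lra. }
      pose proof (wermer_roots t' w Ht') as Hwt.
      (* Propagation also sees points with |w| < 3, where Phi was not maximised; there Phi <= phi <=
         phi p3 < Phi q0 <= Phi p. *)
      destruct (Rle_dec (Cmod w) 3) as [H3|H3].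
      + specialize (Hmax3 (w, CS t') (conj Hwt H3)).
        assert (0 <= del * ln (N2 w)) by (apply Rmult_le_pos; [lra|apply Hln, H1]). lra.
      + change (Phi (w, CS t') <= Phi p). destruct (Rle_dec (Phi q0) (Phi (w, CS t'))) as [H4|H4]; [|lra].
        apply Hmax. split; [exact Hwt|]. split; [cbn; lra|exact H4].
    - exists (Cmod z). split; [exact Hp'|]. unfold u. field. exact HCz.
    - exists 3. split; [lra|reflexivity].
    - rewrite <- Ep. reflexivity. }
  assert (H3 : Cmod (RtoC 3 * u)%C = 3) by (apply Hu; lra).
  specialize (Hmax3 (RtoC 3 * u, CS t)%C (conj (wermer_roots _ _ Ht) (Req_le _ _ H3))).
  assert (0 <= del * ln (N2 (RtoC 3 * u)%C)) by (apply Rmult_le_pos; [lra|apply Hln; lra]).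
  lra.
Qed.

Lemma wermer_liouville V phi M :
  open2 V -> (forall p, wermer_set weps p -> V p) -> continuous_on2 V phi -> psh_on V phi ->
  (forall p, V p -> phi p <= M) ->
  exists c, forall p, wermer_set weps p -> phi p = c.
Proof.
  intros HV HEV Hc Hpsh HM.
  destruct (wermer_max_attained V phi M HV HEV Hc Hpsh HM) as (p & Hp & Hmax).
  destruct (wermer_set_roots p Hp) as (s & Hs & Ep).
  exists (phi p). intros q Hq. apply NNPP. intros Hne.
  assert (He : 0 < Rabs (phi p - phi q)) by (apply Rabs_pos_lt; lra).
  destruct (Hc q (HEV q Hq) _ He) as (d & Hd & Hcd).
  destruct (linked_dense (fun z s => phi (z, CS s) - 0 * ln (N2 z) = phi p)) with (p := q) (e := d)
    as (z & t & Ht & HQ & Hdist); auto.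
  - intros z1 s1 z2 s2 Hs1 Hs2 HL.
    apply (max_propagates V phi 0 (phi p) (fun _ => True)) with (s := s1); auto; try lra.
    intros _ w t _ Ht _. rewrite Rmult_0_l, Rminus_0_r. apply Hmax, wermer_roots, Ht.
  - exists (fst p), s. split; [exact Hs|]. rewrite <- Ep. ring.
  - specialize (Hcd (z, CS t) (HEV _ (wermer_roots _ _ Ht)) Hdist).
    rewrite Rmult_0_l, Rminus_0_r in HQ. rewrite HQ in Hcd. lra.
Qed.

(** * Connectedness *)

(** Failing links of length tending to 0 would accumulate at a point of the limit set. If it lies in
    [U], both ends are eventually in [U]; if in [W], a starting point lies in both sets. *)
Lemma clopen_uniform_step (U W : C2 -> Prop) R0 : open2 U -> open2 W ->
  (forall p, wermer_set weps p -> U p \/ W p) ->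
  (forall p, wermer_set weps p -> U p -> W p -> False) ->
  exists r, 0 < r /\ forall z s z' s', Cmod z <= R0 -> Cmod z' <= R0 -> roots s z -> roots s' z' ->
    linked s s' -> Cmod (z - z')%C <= r -> U (z, CS s) -> U (z', CS s').
Proof.
  intros HU HW Hcov Hdis. apply NNPP. intros Hno.
  (* Base points are taken at distance d^2, so that the 1/2-Hölder estimate bounds the distance of
     the sums by 2 d. *)
  assert (H : forall n : nat, exists x : (C * (nat -> C)) * (C * (nat -> C)),
    (Cmod (fst (fst x)) <= R0 /\ Cmod (fst (snd x)) <= R0) /\
    (roots (snd (fst x)) (fst (fst x)) /\ roots (snd (snd x)) (fst (snd x)) /\
     linked (snd (fst x)) (snd (snd x))) /\
    Cmod (fst (fst x) - fst (snd x))%C <= / (INR n + 1) * / (INR n + 1) /\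
    U (fst (fst x), CS (snd (fst x))) /\ ~ U (fst (snd x), CS (snd (snd x)))).
  { intros n. apply NNPP. intros Hn. apply Hno. exists (/ (INR n + 1) * / (INR n + 1)).
    pose proof (inv_INR_pos n). split; [nra|].
    intros z s z' s' Hz Hz' Hs Hs' HL Hd HUz. apply NNPP. intros HnU. apply Hn.
    exists ((z, s), (z', s')). cbn [fst snd]. tauto. }
  pose (x := fun n => proj1_sig (constructive_indefinite_description _ (H n))).
  assert (Hx : forall n,
    (Cmod (fst (fst (x n))) <= R0 /\ Cmod (fst (snd (x n))) <= R0) /\
    (roots (snd (fst (x n))) (fst (fst (x n))) /\ roots (snd (snd (x n))) (fst (snd (x n))) /\
     linked (snd (fst (x n))) (snd (snd (x n)))) /\
    Cmod (fst (fst (x n)) - fst (snd (x n)))%C <= / (INR n + 1) * / (INR n + 1) /\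
    U (fst (fst (x n)), CS (snd (fst (x n)))) /\ ~ U (fst (snd (x n)), CS (snd (snd (x n)))))
    by (intros n; exact (proj2_sig (constructive_indefinite_description _ (H n)))).
  destruct (wermer_bounded_subseq (fun n => (fst (fst (x n)), CS (snd (fst (x n))))) R0)
    as (sg & p & Hsg & Hp & Hcv).
  { intros n. apply wermer_roots, Hx. }
  { intros n. apply Hx. }
  destruct (Hcov p Hp) as [HUp|HWp].
  - destruct (HU p HUp) as (r & Hr & Hball).
    destruct (Hcv (r / 4) ltac:(lra)) as [N HN].
    destruct (inv_INR_small (Rmin 1 (r / 8)) ltac:(apply Rmin_pos; lra)) as [N' HN'].
    set (n := max N N'). specialize (HN n ltac:(lia)).
    specialize (HN' (sg n) ltac:(pose proof (mono_ge sg Hsg n); lia)).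
    set (d := / (INR (sg n) + 1)) in *.
    assert (Hd0 : 0 < d) by apply inv_INR_pos.
    assert (Hd1 : d < 1) by (apply Rlt_le_trans with (1 := HN'), Rmin_l).
    assert (Hd2 : d < r / 8) by (apply Rlt_le_trans with (1 := HN'), Rmin_r).
    destruct (Hx (sg n)) as ((Hb1 & Hb2) & (Hs1 & Hs2 & HL) & Hd & _ & HnU). fold d in Hd.
    apply HnU, Hball.
    pose proof (linked_CS_dist _ _ _ _ R0 Hs1 Hs2 HL Hb1 Hb2) as Hcs.
    set (z1 := fst (fst (x (sg n)))) in *. set (z2 := fst (snd (x (sg n)))) in *.
    set (w1 := CS (snd (fst (x (sg n))))) in *. set (w2 := CS (snd (snd (x (sg n))))) in *.
    assert (Hw : Cmod (w1 - w2)%C <= 2 * d) by (pose proof (Cmod_ge_0 (w1 - w2)%C); nra).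
    pose proof (Cmod_fst_dist2 (z1, w1) p) as D1. pose proof (Cmod_snd_dist2 (z1, w1) p) as D2.
    apply Rle_lt_trans with (1 := dist2_le_sum _ _). cbn [fst snd] in *.
    pose proof (Cmod_triangle3 (fst p) z1 z2) as T1. pose proof (Cmod_triangle3 (snd p) w1 w2) as T2.
    rewrite (Cmod_minus_sym (fst p) z1) in T1. rewrite (Cmod_minus_sym (snd p) w1) in T2.
    assert (d * d <= d) by nra. lra.
  - destruct (HW p HWp) as (r & Hr & Hball). destruct (Hcv r Hr) as [N HN].
    specialize (HN N (le_n _)). rewrite dist2_sym in HN.
    destruct (Hx (sg N)) as (_ & (Hs1 & _) & _ & HUx & _).
    exact (Hdis _ (wermer_roots _ _ Hs1) HUx (Hball _ HN)).
Qed.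

(** Membership in [U] propagates along links, so by density it reaches the ball around [q] inside
    [W]. *)
Lemma wermer_connected : connected2 (wermer_set weps).
Proof.
  intros U W HU HW Hcov (p & Hp & HUp) (q & Hq & HWq). apply NNPP. intros Hno.
  assert (Hdis : forall p, wermer_set weps p -> U p -> W p -> False).
  { intros x Hx H1 H2. apply Hno. exists x. auto. }
  destruct (HW q HWq) as (d & Hd & Hball).
  destruct (wermer_set_roots p Hp) as (s & Hs & Ep).
  destruct (linked_dense (fun z s => U (z, CS s))) with (p := q) (e := d)
    as (z & t & Ht & HQ & Hdist); auto.
  - intros z1 s1 z2 s2 Hs1 Hs2 HL.
    (* The step length depends on a bound for the base points; this disc contains the whole
       segment. *)
    set (R0 := Rmax (Cmod z1) (Cmod z2)).
    destruct (clopen_uniform_step U W R0 HU HW Hcov Hdis) as (r & Hr & Hstep).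
    apply (linked_halving (fun z => Cmod z <= R0) (fun z s => U (z, CS s)) r); auto.
    + intros x y Hx Hy. rewrite Cmod_div by (intros E; injection E; lra).
      rewrite Cmod_R, Rabs_pos_eq by lra. pose proof (Cmod_triangle x y). lra.
    + apply Rmax_l.
    + apply Rmax_r.
  - exists (fst p), s. split; [exact Hs|]. rewrite <- Ep. exact HUp.
  - exact (Hdis _ (wermer_roots _ _ Ht) HQ (Hball _ Hdist)).
Qed.

Theorem theorem6p1 :
  exists eps : nat -> R,
    (forall n, (1 <= n)%nat -> 0 < eps n) /\
    (forall n, (1 <= n)%nat -> eps (S n) < eps n) /\
    is_lim_seq eps 0 /\
    (exists p, wermer_set eps p) /\
    unbounded2 (wermer_set eps) /\
    connected2 (wermer_set eps) /\
    closed2 (wermer_set eps) /\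
    local_hausdorff_cv (E_n eps) (wermer_set eps) /\
    (forall (V : C2 -> Prop) (phi : C2 -> R),
        open2 V -> (forall p, wermer_set eps p -> V p) ->
        continuous_on2 V phi -> psh_on V phi ->
        (exists M, forall p, V p -> phi p <= M) ->
        exists c : R, forall p, wermer_set eps p -> phi p = c).
Proof.
  exists weps.
  split; [intros n _; apply weps_pos|].
  split; [intros n _; apply weps_decr|].
  split; [exact weps_lim|].
  split; [exact wermer_nonempty|].
  split; [exact wermer_unbounded|].
  split; [exact wermer_connected|].
  split; [exact wermer_closed|].
  split; [exact wermer_hausdorff|].
  intros V phi HV HEV Hc Hpsh [M HM]. exact (wermer_liouville V phi M HV HEV Hc Hpsh HM).
Qed.
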